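(* Let $d\in\mathbb N$, $m>1$, and let $\{u^z\}_{z\in\mathbb R^d}$ be the Barenblatt solutions of the porous medium equation $\partial_tu=\Delta(u^m)$. Consider the distribution-dependent ODE $$dX_t=-\frac{\nabla u^m(t,X_t)}{u(t,X_t)}\,dt,\qquad\mathcal L(X_t)=u(t,x)\,dx,\ t>0.\qquad(\ast)$$ For every $z\in\mathbb R^d$, the process $X^{0,z}_t:=z+\eta\,t^{\frac kd}$, $t\ge0$, where $k=(m-1+\frac2d)^{-1}$ and $\eta$ is an $\mathbb R^d$-valued random variable with $\mathcal L(\eta)=u^0(1,x)\,dx$ (the Barenblatt solution centred at $z=0$ at time $1$), is the unique weak solution to $(\ast)$ with $\mathcal L(X^{0,z}_t)=u^z(t,x)\,dx$, $t>0$, and $\mathcal L(X^{0,z}_0)=\delta_z$. Furthermore, the family of solution path laws $\{\mathbb V^{0,z}\}_{z\in\mathbb R^d}$, $\mathbb V^{0,z}:=\mathcal L(X^{0,z})$, is a nonlinear Markov core for $\{u^z\}_{z\in\mathbb R^d}$, which is uniquely determined by $\{u^z\}_{z\in\mathbb R^d}$ and $(\ast)$ (i.e. it is the only nonlinear Markov core for $\{u^z\}_{z\in\mathbb{R}^d}$ consisting of solution path laws to $(\ast)$).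
   Context: Barenblatt solution: $u^z(t,x)=t^{-k}\big(C-q\,t^{-\frac{2k}d}|x-z|^2\big)_+^{\frac1{m-1}}$, $t>0$, with $k=(m-1+\frac2d)^{-1}$, $q=\frac kd\frac{m-1}{2m}$, and $C=C_{m,d}>0$ the unique constant making $\int u^z(t,x)dx=1$ for all $t>0$; $u^z(t,x)dx\to\delta_z$ weakly as $t\downarrow0$. $\nabla u^m=\nabla(u^m)$. The drift of $(\ast)$ is considered for $u\in\mathcal P_*:=\{u\in\mathcal P_{\mathrm{ac}}:u^m\in W^{1,1}_{\mathrm{loc}}(\mathbb R^d)\}$ and set to $0$ on $\{u=0\}$. Weak solution of $(\ast)$: a continuous adapted process $X$ on a filtered probability space with $\mathcal L(X_t)=u(t,x)dx\in\mathcal P_*$ for $t>0$, drift along $X$ in $L^1(\Omega\times[0,T])$ for all $T>0$, and a.s. the integral form of the equation for all $t\ge0$. A solution path law is the law on $\mathcal C$ of a weak solution. ''Unique'': any two weak solutions with the stated one-dimensional time marginals have the same path law. Notation: $\mathbb R_+=[0,\infty)$; $\mathcal P(T)$ is the set of Borel probability measures on $T$, $\mathcal P=\mathcal P(\mathbb R^d)$, $\mathcal P_{\mathrm{ac}}$ the absolutely continuous ones, identified with densities. $\mathcal C=C(\mathbb R_+;\mathbb R^d)$ with locally uniform convergence and Borel $\sigma$-algebra, $\pi_t(w)=w(t)$, $\mathcal F_t=\sigma(\pi_s:s\le t)$, $\Pi_t(w)=w(t+\cdot)$, $P_t:=P\circ\pi_t^{-1}$ for $P\in\mathcal P(\mathcal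 C)$. Nonlinear Markov process: a family $\{P^\zeta\}_{\zeta\in\mathcal P_0}\subset\mathcal P(\mathcal C)$, $\mathcal P_0\subseteq\mathcal P$, such that with $\mu^\zeta_t:=P^\zeta_t$: (i) $\mu^\zeta_0=\zeta$; (ii) $\mu^\zeta_t\in\mathcal P_0$ for all $t>0$; (iii) for all $s,t\ge0$, $\zeta\in\mathcal P_0$, $A\in\mathcal B(\mathbb R^d)$: $P^\zeta(\pi_{t+s}\in A\mid\mathcal F_s)(\cdot)=P^{\mu^\zeta_s,\pi_s(\cdot)}(\pi_t\in A)$ $P^\zeta$-a.s., where $\{P^{\xi,y}\}_y$ is, for $\xi\in\mathcal P_0$, the disintegration of $P^\xi$ with respect to $\pi_0$ (measurable in $y$, $P^\xi=\int P^{\xi,y}d\xi(y)$, $P^{\xi,y}(\pi_0=y)=1$ for $\xi$-a.e. $y$). Nonlinear Markov core: for $\{\mu^z_t\}_{t\ge0,z\in\mathbb R^d}\subset\mathcal P$ with $\mu^z_0=\delta_z$ and $(t,z)\mapsto\mu^z_t$ injective, $\{P^z\}_{z}\subset\mathcal P(\mathcal C)$ is a nonlinear Markov core for $\{\mu^z_t\}$ if $P^z_t=\mu^z_t$ for all $t\ge0$, $z\in\mathbb R^d$, and $\{P^\zeta\}_{\zeta\in\mathcal P_0}$, with $\mathcal P_0:=\{\mu^z_t:t\ge0,z\in\mathbb R^d\}$ and $P^\zeta:=P^z\circ\Pi_t^{-1}$ for $\zeta=\mu^z_t$, is a nonlinear Markov process. ''Core for $\{u^z\}$'' means with $\mu^z_t=u^z(t,x)dx$,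 $t>0$, $\mu^z_0=\delta_z$. *)

(* Defs.v *)
From HB Require Import structures.
From mathcomp Require Import all_boot all_order all_algebra.
From mathcomp Require Import all_classical all_reals all_analysis.
From mathcomp Require Import measurable_realfun.
From mathcomp Require Import ring lra.

Set Implicit Arguments.
Unset Strict Implicit.
Unset Printing Implicit Defensive.

Import Order.TTheory GRing.Theory Num.Theory numFieldNormedType.Exports.

Local Open Scope classical_set_scope.
Local Open Scope ring_scope.

(* Elements of {measure set T -> \bar R} carry junk values outside the
   sigma-algebra, so equality of laws is equality on measurable sets only. *)
Definition same_law d (T : measurableType d) (R : realType)
    (p q : set T -> \bar R) : Prop :=
  forall A, measurable A -> p A = q A.

Fact borel_mx_display : measure_display.
Proof. by constructor. Qed.

Section borel_mx.
Variables (R : realType) (p q : nat).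

HB.instance Definition _ := @isMeasurable.Build borel_mx_display
  'M[R]_(p, q) <<s open >> (@sigma_algebra0 _ setT open)
  (@sigma_algebraC _ open) (@sigma_algebra_bigcup _ setT open).

End borel_mx.

Section borel_mx_theory.
Variable (R : realType).

Lemma measurable_open_mx p q (U : set 'M[R]_(p, q)) : open U -> measurable U.
Proof. exact: sub_sigma_algebra. Qed.

Let rbox p q (c : 'M[rat]_(p, q) * nat) : set 'M[R]_(p, q) :=
  \bigcap_i \bigcap_j
    ((fun x => x i j) @^-1` ball (ratr (c.1 i j) : R) (c.2.+1%:R^-1)).

Lemma open_mx_rbox p q (U : set 'M[R]_(p, q)) : open U ->
  U = \bigcup_(c in [set c | @rbox p q c `<=` U]) @rbox p q c.
Proof.
move=> oU; apply/seteqP; split=> [x Ux|x [c /= cU]]; last exact: cU.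
have /nbhs_ballP[e /= e0 eU] : nbhs x U by exact: open_nbhs_nbhs.
have e2 : 0 < e / 2 by lra.
have [n _ /(_ n (leqnn n)) /=] := near_infty_natSinv_lt (PosNum e2).
have : 0 < n.+1%:R^-1 :> R by rewrite invr_gt0.
set a := n.+1%:R^-1 => a0 ae.
have gex i j : exists r, `|ratr r - x i j| < a.
  have xa : x i j - a < x i j + a by lra.
  have [r] := rat_in_itvoo xa.
  by rewrite in_itv/= => /andP[h1 h2]; exists r; rewrite ltr_norml; lra.
exists (\matrix_(i, j) projT1 (cid (gex i j)), n).
  move=> y hy; apply: eU; split=> // i j.
  move: (hy i I j I) (projT2 (cid (gex i j))).
  rewrite /= mxE /ball /= -/a !ltr_norml => h1 h2.
  by lra.
move=> i _ j _ /=; rewrite mxE /ball /= -/a.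
exact: projT2 (cid (gex i j)).
Qed.

Lemma measurable_fun_mx d (T : measurableType d) p q (f : T -> 'M[R]_(p, q)) :
  (forall i j, measurable_fun setT (fun x => f x i j)) ->
  measurable_fun setT f.
Proof.
move=> mf; apply: (@measurability _ _ _ _ setT f open erefl).
move=> _ [U oU <-]; rewrite setTI (open_mx_rbox oU) preimage_bigcup.
rewrite bigcup_mkcond; apply: countable_bigcupT_measurable => // c.
case: ifPn => // _; rewrite /rbox preimage_bigcap.
apply: fin_bigcap_measurable => // i _; rewrite preimage_bigcap.
apply: fin_bigcap_measurable => // j _.
by rewrite -[X in measurable X]setTI; apply: (mf i j) => //;
   exact: measurable_ball.
Qed.

Lemma measurable_coord p q i j :
  measurable_fun setT (fun x : 'M[R]_(p, q) => x i j).
Proof.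
apply: (measurability _ (RGenOpens.measurableE R)) => _ [_ [a [b ->]] <-].
rewrite setTI; apply: measurable_open_mx.
by apply: open_comp => [x _|]; [exact: coord_continuous|exact: interval_open].
Qed.

End borel_mx_theory.

Section lebesgue_rV.
Variable (R : realType).

Definition cons_rV n (xv : R * 'rV[R]_n) : 'rV[R]_n.+1 :=
  row_mx (\row_(_ < 1) xv.1) xv.2.

Lemma measurable_cons_rV n : measurable_fun setT (@cons_rV n).
Proof.
apply: measurable_fun_mx => i j; rewrite /cons_rV.
case: (split_ordP (j : 'I_(1 + n))) => k ->.
  rewrite [X in measurable_fun _ X](_ : _ = fst); first exact: measurable_fst.
  by apply/funext => x; rewrite [LHS]row_mxEl mxE.
rewrite [X in measurable_fun _ X](_ : _ = (fun v : 'rV[R]_n => v i k) \o snd).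
  exact: (measurableT_comp (@measurable_coord R 1 n i k) measurable_snd).
by apply/funext => x; rewrite [LHS]row_mxEr.
Qed.

Section cons_measure.
Local Open Scope ereal_scope.
Variables (n : nat) (mu : {measure set 'rV[R]_n -> \bar R}).

Definition cons_measure : set 'rV[R]_n.+1 -> \bar R :=
  pushforward (@lebesgue_measure R \x^ mu) (@cons_rV n).

Let mcons := @measurable_cons_rV n.

Let cons_measure0 : cons_measure set0 = 0.
Proof. exact: measure0. Qed.

Let cons_measure_ge0 A : 0 <= cons_measure A.
Proof. exact: measure_ge0. Qed.

Let cons_measure_sigma_additive : semi_sigma_additive cons_measure.
Proof. exact: measure_semi_sigma_additive. Qed.

HB.instance Definition _ := isMeasure.Build _ _ _ cons_measure
  cons_measure0 cons_measure_ge0 cons_measure_sigma_additive.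

End cons_measure.

Fixpoint lebesgue_rV n : {measure set 'rV[R]_n -> \bar R} :=
  if n is n'.+1 then cons_measure (lebesgue_rV n') else \d_(0 : 'rV[R]_0).

End lebesgue_rV.

Definition time (R : realType) : Type := {nonneg R}.

Section time.
Variable (R : realType).

HB.instance Definition _ := Choice.on (time R).
HB.instance Definition _ := Topological.copy (time R)
  (initial_topology (fun t : {nonneg R} => t%:num)).

Definition rtime (t : time R) : R := (t : {nonneg R})%:num.

(* The identity on R_+; its values at negative reals are never used. *)
Definition to_time (s : R) : time R := `|s|%:nng.

Definition addt (s t : time R) : time R :=
  ((s : {nonneg R})%:num + (t : {nonneg R})%:num)%:nng.

Lemma rtime_continuous : continuous rtime.
Proof. exact: initial_continuous. Qed.

Lemma addt_continuous (s : time R) : continuous (addt s).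
Proof.
have : continuous (rtime \o addt s).
  move=> t; apply: (@cvgD _ _ _ (nbhs t) _ (cst (rtime s)) rtime).
    exact: cvg_cst.
  exact: rtime_continuous.
exact: (@continuous_comp_initial _ _ _ (fun t : {nonneg R} => t%:num)).
Qed.

End time.

Definition path_space (R : realType) (d : nat) : Type :=
  continuousType (time R) 'rV[R]_d.

Fact path_display : measure_display.
Proof. by constructor. Qed.

Section path_space.
Variables (R : realType) (d : nat).

HB.instance Definition _ := gen_eqMixin (path_space R d).
HB.instance Definition _ := gen_choiceMixin (path_space R d).
HB.instance Definition _ := isPointed.Build (path_space R d)
  (cst 0 : continuousType (time R) 'rV[R]_d).

Definition path_at (t : time R) (w : path_space R d) : 'rV[R]_d := w t.

(* Locally uniform convergence is uniform convergence on compact sets. *)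
HB.instance Definition _ := Topological.copy (path_space R d)
  (initial_topology (fun w : path_space R d =>
     (path_at ^~ w : {family compact, time R -> 'rV[R]_d}))).

HB.instance Definition _ := @isMeasurable.Build path_display
  (path_space R d) <<s open >> (@sigma_algebra0 _ setT open)
  (@sigma_algebraC _ open) (@sigma_algebra_bigcup _ setT open).

Lemma path_at_continuous (t : time R) : continuous (path_at t).
Proof.
move=> w.
have /pointwise_cvg_compact_family/pointwise_cvgP : {family compact,
    (fun v : path_space R d => path_at ^~ v) @ w --> path_at ^~ w}.
  exact: (@initial_continuous _ {family compact, time R -> 'rV[R]_d}).
by move=> h; refine (h _ _ t); apply: fmap_filter; exact: nbhs_filter.
Qed.

Lemma measurable_path_at (t : time R) : measurable_fun setT (path_at t).
Proof.
apply: (@measurability _ _ _ _ setT (path_at t) open erefl) => _ [U oU <-].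
rewrite setTI; apply: sub_sigma_algebra; apply: open_comp => // w _.
exact: path_at_continuous.
Qed.

HB.instance Definition _ (t : time R) :=
  isMeasurableFun.Build _ _ _ _ (path_at t) (measurable_path_at t).

Definition marginal (P : probability (path_space R d) R) (t : time R) :
  probability 'rV[R]_d R := distribution P (path_at t).

Lemma shift_continuous (s : time R) (w : path_space R d) :
  continuous (fun t => w (addt s t)).
Proof.
move=> t; apply: continuous_comp; first exact: addt_continuous.
exact: cts_fun.
Qed.

Definition path_shift (s : time R) (w : path_space R d) : path_space R d :=
  mkcts (@shift_continuous s w).

End path_space.

Section barenblatt.
Variables (R : realType) (d : nat) (m : R).

Definition barenblatt_k : R := (m - 1 + 2 / d%:R)^-1.

Definition barenblatt_q : R := barenblatt_k / d%:R * ((m - 1) / (2 * m)).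

(* The norm of 'rV[R]_d in the library is the sup norm. *)
Definition sqnorm2 (x : 'rV[R]_d) : R := \sum_(i < d) x 0 i ^+ 2.

Definition barenblatt_of (C : R) (z : 'rV[R]_d) (t : R) (x : 'rV[R]_d) : R :=
  t `^ (- barenblatt_k) *
  Num.max 0 (C - barenblatt_q * t `^ (- (2 * barenblatt_k / d%:R))
                 * sqnorm2 (x - z)) `^ (m - 1)^-1.

Definition barenblatt_C : R :=
  get [set C : R | 0 < C /\ forall z t, 0 < t ->
    (\int[lebesgue_rV R d]_x (barenblatt_of C z t x)%:E = 1)%E].

Definition barenblatt : 'rV[R]_d -> R -> 'rV[R]_d -> R :=
  barenblatt_of barenblatt_C.

Definition density_law (u : 'rV[R]_d -> R) (A : set 'rV[R]_d) : \bar R :=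
  (\int[lebesgue_rV R d]_(x in A) (u x)%:E)%E.

Definition barenblatt_flow (t : time R) (z : 'rV[R]_d) :
    set 'rV[R]_d -> \bar R :=
  if rtime t == 0 then \d_z else density_law (barenblatt z (rtime t)).

Lemma powR_rtime_continuous (a : R) : 0 <= a ->
  continuous (fun t : time R => rtime t `^ a).
Proof.
rewrite le_eqVlt => /predU1P[<-|a0] t.
  rewrite (_ : (fun s => rtime s `^ 0) = cst 1); first exact: cst_continuous.
  by apply/funext => s; rewrite powRr0.
have t0 : 0 <= rtime t by rewrite /rtime.
move: t0; rewrite le_eqVlt => /predU1P[t0|t0].
  apply/(@cvgrPdist_lt _ _ _ (nbhs t) (nbhs_filter t)) => e e0 /=; rewrite -t0 powR0 ?gt_eqF//.
  have /cvgrPdist_lt/(_ _ e0) [r /= r0 rP] := powR_cvg0 a0.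
  have /(@cvgrPdist_lt _ _ _ (nbhs t) (nbhs_filter t))/(_ _ r0) :=
    @rtime_continuous R t.
  apply: filterS => s; rewrite -t0.
  have : 0 <= rtime s by rewrite /rtime.
  rewrite le_eqVlt => /predU1P[<-|s0] sr; last exact: rP.
  by rewrite powR0 ?gt_eqF// subrr normr0.
have /differentiable_continuous pa :
    differentiable (fun x : R => x `^ a) (rtime t).
  by apply/derivable1_diffP/derivable_powR; rewrite in_itv/= t0.
by move=> U /pa; exact: (@rtime_continuous R t).
Qed.

Hypothesis m1 : 1 < m.

Lemma barenblatt_path_continuous (z y : 'rV[R]_d) :
  continuous (fun t : time R => z + rtime t `^ (barenblatt_k / d%:R) *: y).
Proof.
move=> t; apply: (@cvgD _ _ _ (nbhs t) _ (cst z)); first exact: cvg_cst.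
apply: (@cvgZr_tmp _ _ _ (nbhs t)); apply: powR_rtime_continuous.
by rewrite divr_ge0// invr_ge0 addr_ge0 ?divr_ge0// subr_ge0 ltW.
Qed.

Definition barenblatt_path (z y : 'rV[R]_d) : path_space R d :=
  mkcts (@barenblatt_path_continuous z y).

End barenblatt.

Arguments barenblatt_path {R d m} m1 z y.

Section sobolev.
Variables (R : realType) (d : nat).
Local Notation mu := (lebesgue_rV R d).

Definition partial (i : 'I_d) (f : 'rV[R]_d -> R) : 'rV[R]_d -> R :=
  fun x => 'D_(delta_mx 0 i) f x.

(* C^oo: all iterated partial derivatives exist and are differentiable. *)
Definition smooth (f : 'rV[R]_d -> R) : Prop :=
  forall (s : seq 'I_d) x, differentiable (foldr partial f s) x.

Definition test_function (phi : 'rV[R]_d -> R) : Prop :=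
  smooth phi /\ compact (closure [set x | phi x != 0]).

Definition loc_integrable (f : 'rV[R]_d -> R) : Prop :=
  measurable_fun setT f /\
  forall K, compact K -> (\int[mu]_(x in K) `|f x|%:E < +oo)%E.

Definition is_weak_gradient (f : 'rV[R]_d -> R) (g : 'rV[R]_d -> 'rV[R]_d) :
    Prop :=
  (forall i, loc_integrable (fun x => g x 0 i)) /\
  (forall i phi, test_function phi ->
     \int[mu]_x (f x * partial i phi x) = - \int[mu]_x (g x 0 i * phi x)).

Definition W11loc (f : 'rV[R]_d -> R) : Prop :=
  loc_integrable f /\ exists g, is_weak_gradient f g.

Definition prob_density (u : 'rV[R]_d -> R) : Prop :=
  [/\ measurable_fun setT u, forall x, 0 <= u x & density_law u setT = 1%E].

Definition Pstar (m : R) (u : 'rV[R]_d -> R) : Prop :=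
  prob_density u /\ W11loc (fun x => u x `^ m).

End sobolev.

Section weak_solution.
Variables (R : realType) (d : nat).
Context (dO : measure_display) (Omega : measurableType dO).

Definition is_filtration (G : time R -> set (set Omega)) : Prop :=
  [/\ forall t, sigma_algebra setT (G t),
      forall t, G t `<=` measurable &
      forall s t, rtime s <= rtime t -> G s `<=` G t].

Definition adapted (G : time R -> set (set Omega))
    (X : Omega -> path_space R d) : Prop :=
  forall t A, measurable A -> G t ((fun w => X w t) @^-1` A).

Definition natural_filtration (X : Omega -> path_space R d) (t : time R) :
    set (set Omega) :=
  <<s \bigcup_(s in [set s | rtime s <= rtime t])
        preimage_set_system setT (fun w => X w s) measurable >>.

Definition pme_drift (u : 'rV[R]_d -> R) (grad : 'rV[R]_d -> 'rV[R]_d)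
    (x : 'rV[R]_d) : 'rV[R]_d :=
  if u x == 0 then 0 else - ((u x)^-1 *: grad x).

(* For t > 0, u t and grad t are determined up to Lebesgue-null sets, and X_t
   has a density: the drift along X is determined P (x) dt-a.e., and it is
   represented by the component functions b i below. *)
Definition weak_solution (m : R) (P : probability Omega R)
    (G : time R -> set (set Omega)) (X : Omega -> path_space R d) : Prop :=
  [/\ is_filtration G, adapted G X &
   exists (u : R -> 'rV[R]_d -> R) (grad : R -> 'rV[R]_d -> 'rV[R]_d),
   let b (i : 'I_d) (w : Omega) (s : R) : R :=
     pme_drift (u s) (grad s) (X w (to_time s)) 0 i in
   [/\ forall t : time R, 0 < rtime t ->
         [/\ same_law (pushforward P (fun w => X w t))
               (density_law (u (rtime t))),
             Pstar m (u (rtime t)) &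
             is_weak_gradient (fun x => u (rtime t) x `^ m) (grad (rtime t))],
       forall (T : R) i, 0 < T ->
         (P \x @lebesgue_measure R)%E.-integrable (setT `*` `[0, T])
           (fun ws => (b i ws.1 ws.2)%:E) &
       {ae P, forall w, forall t i,
          X w t 0 i = X w (to_time 0) 0 i +
            \int[@lebesgue_measure R]_(s in `[0, rtime t]) b i w s}]].

Definition has_barenblatt_marginals (m : R) (z : 'rV[R]_d)
    (P : probability Omega R) (X : Omega -> path_space R d) : Prop :=
  forall t, same_law (pushforward P (fun w => X w t)) (barenblatt_flow m t z).

End weak_solution.

Definition unique_barenblatt_solution (R : realType) (d : nat) (m : R)
    (z : 'rV[R]_d) : Prop :=
  forall dO1 (Omega1 : measurableType dO1) (P1 : probability Omega1 R) G1
         (X1 : Omega1 -> path_space R d)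
         dO2 (Omega2 : measurableType dO2) (P2 : probability Omega2 R) G2
         (X2 : Omega2 -> path_space R d),
    weak_solution m P1 G1 X1 -> has_barenblatt_marginals m z P1 X1 ->
    weak_solution m P2 G2 X2 -> has_barenblatt_marginals m z P2 X2 ->
    same_law (pushforward P1 X1) (pushforward P2 X2).

Definition solution_path_law (R : realType) (d : nat) (m : R)
    (Q : probability (path_space R d) R) : Prop :=
  exists dO (Omega : measurableType dO) (P : probability Omega R) G
         (X : Omega -> path_space R d),
    weak_solution m P G X /\ same_law Q (pushforward P X).

Section nonlinear_markov.
Variables (R : realType) (d : nat).
Local Notation Rd := 'rV[R]_d.
Local Notation path := (path_space R d).

Definition path_filtration : time R -> set (set path) :=
  natural_filtration (@id path).

Definition is_cond_prob (Q : probability path R) (S : set (set path))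
    (B : set path) (f : path -> \bar R) : Prop :=
  (forall E : set (\bar R), measurable E -> S (f @^-1` E)) /\
  (forall F, S F -> (\int[Q]_(w in F) f w)%E = Q (B `&` F)).

Definition is_disintegration (Q : probability path R) (xi : probability Rd R)
    (kappa : R.-pker Rd ~> path) : Prop :=
  (forall B, measurable B -> Q B = (\int[xi]_y kappa y B)%E) /\
  {ae xi, forall y, kappa y [set w | w (to_time 0) = y] = 1%E}.

(* A set of laws, and a family indexed by it, are given by a predicate and a
   function compatible with same_law. *)
Definition nonlinear_markov (P0 : set (probability Rd R))
    (Pf : probability Rd R -> probability path R) : Prop :=
  [/\ forall xi zeta : probability Rd R, same_law xi zeta -> P0 zeta ->
        P0 xi /\ same_law (Pf xi) (Pf zeta),
      forall zeta, P0 zeta -> same_law (marginal (Pf zeta) (to_time 0)) zeta,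
      forall zeta t, P0 zeta -> 0 < rtime t -> P0 (marginal (Pf zeta) t) &
      exists kappa : probability Rd R -> R.-pker Rd ~> path,
        (forall xi, P0 xi -> is_disintegration (Pf xi) xi (kappa xi)) /\
        (forall s t zeta A, P0 zeta -> measurable A ->
           is_cond_prob (Pf zeta) (path_filtration s)
             [set w : path | A (w (addt t s))]
             (fun w => kappa (marginal (Pf zeta) s) (w s)
                         [set w' : path | A (w' t)]))].

Definition nonlinear_markov_core (mu : time R -> Rd -> set Rd -> \bar R)
    (P : Rd -> probability path R) : Prop :=
  [/\ forall z, same_law (mu (to_time 0) z) \d_z,
      forall t z t' z', same_law (mu t z) (mu t' z') -> t = t' /\ z = z',
      forall t z, same_law (marginal (P z) t) (mu t z) &
      exists Pf : probability Rd R -> probability path R,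
        (forall t z (zeta : probability Rd R), same_law zeta (mu t z) ->
           same_law (Pf zeta) (pushforward (P z) (path_shift t))) /\
        nonlinear_markov
          [set zeta : probability Rd R | exists t z, same_law zeta (mu t z)] Pf].

End nonlinear_markov.

(* Main.v *)
Require Import Defs.
From HB Require Import structures.
From mathcomp Require Import all_boot all_order all_algebra.
From mathcomp Require Import all_classical all_reals all_analysis.
From mathcomp Require Import measurable_realfun.
From mathcomp Require Import ring lra.

(** The profile of a Barenblatt solution is explicit, and on its positivity set
    its velocity is linear in space: - grad (u^m) / u = (beta / t) (x - z) with
    beta = k / d. The trajectories leaving z are therefore z + t^beta y, one for
    each y. Scaling the profile together with Lebesgue measure shows that the
    density at time t is the image of the centred density at time 1 under
    y |-> z + t^beta y; hence the process z + t^beta eta has the prescribed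
    marginals ([barenblatt_process_marginals]). It is a weak solution
    ([barenblatt_process_weak_solution]) because eta almost surely
    takes its values in the bounded positivity set and s^(beta - 1) is integrable
    at 0.

    Conversely, let X be a weak solution with these marginals. A weak gradient
    is determined up to a null set by the fundamental lemma of the calculus of
    variations, for which smooth bumps are built from exp (- 1 / y); so at each
    time t > 0 the drift along X is almost surely (beta / t) (X_t - z)
    ([drift_along]). By Fubini almost every path satisfies, on positive times,
    x' = (beta / t) (x - z), an equation whose solutions are constant after
    division of x - z by t^beta. Thus X_t = z + t^beta (X_1 - z) for all t
    ([weak_solution_path]). All these curves start in z, so that the equation
    alone does not select one of them, but the law of X_1 is prescribed, and
    with it the law of X ([weak_solution_law]).

    For the Markov property, the time and the centre can be read off from a law
    of the flow ([barenblatt_flow_inj]): a profile is maximal exactly at its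
    centre, with a maximum that decreases in time, and a law with a density is
    not a Dirac mass. Given the time r > 0 and the centre z, the position y at
    time r fixes the rest of the path, z + (r + t)^beta r^(- beta) (y - z), and
    the kernel is a Dirac mass on that path; for r = 0 the position carries no
    information, and the kernel is constant, equal to the law of the whole
    process. The identity for conditional probabilities is then an evaluation
    along z + t^beta eta when the time is positive; at time 0 it holds because
    events known at time 0 do not separate paths that start in the same point
    ([core_kernel_markov]). Any other core of solution path laws has the same
    marginals, so it coincides with this one by uniqueness of weak solutions. *)

Set Implicit Arguments.
Unset Strict Implicit.
Unset Printing Implicit Defensive.

Import Order.TTheory GRing.Theory Num.Theory numFieldNormedType.Exports.

Local Open Scope classical_set_scope.
Local Open Scope ring_scope.

(** * Lebesgue measure on row vectors *)

Section measurable_rV.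
Variables (R : realType) (n : nat).

Lemma measurable_affine_rV (z : 'rV[R]_n) (c : R) :
  measurable_fun setT (fun y : 'rV[R]_n => z + c *: y).
Proof.
apply: measurable_fun_mx => i j; under eq_fun do rewrite !mxE.
by apply: measurable_funD => //; apply: measurable_funM => //; exact: measurable_coord.
Qed.

Lemma measurable_affine_preimage (z : 'rV[R]_n) (c : R) (A : set 'rV[R]_n) :
  measurable A -> measurable [set y | A (z + c *: y)].
Proof.
by move=> mA; rewrite -[X in measurable X]setTI; exact: measurable_affine_rV.
Qed.

Lemma measurable_compact_rV (K : set 'rV[R]_n) : compact K -> measurable K.
Proof.
move=> cK; rewrite -[K]setCK; apply: measurableC; apply: measurable_open_mx.
by rewrite openC; apply: compact_closed => //; exact: norm_hausdorff.
Qed.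

Lemma measurable_set1_rV (x : 'rV[R]_n) : measurable [set x].
Proof. by apply: measurable_compact_rV; exact: compact_set1. Qed.

Lemma continuous_measurable_rV (f : 'rV[R]_n -> R) :
  continuous f -> measurable_fun setT f.
Proof.
move=> /continuousP cf.
apply: (measurability _ (RGenOpens.measurableE R)) => _ [_ [a [b ->]] <-].
by rewrite setTI; apply: measurable_open_mx; apply: cf; exact: interval_open.
Qed.

End measurable_rV.

Section lebesgue_rV_fubini.
Variable R : realType.

Lemma cons_rV0 n (xv : R * 'rV[R]_n) : cons_rV xv 0 ord0 = xv.1.
Proof.
have -> : ord0 = lshift n (ord0 : 'I_1) by apply: val_inj.
by rewrite [LHS]row_mxEl mxE.
Qed.

Lemma cons_rVS n (xv : R * 'rV[R]_n) j : cons_rV xv 0 (lift ord0 j) = xv.2 0 j.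
Proof.
have -> : lift ord0 j = rshift 1 j by apply: val_inj.
by rewrite [LHS]row_mxEr.
Qed.

Definition tail_rV n (x : 'rV[R]_n.+1) : 'rV[R]_n := \row_j x 0 (lift ord0 j).

Lemma cons_rV_tail n (x : 'rV[R]_n.+1) : cons_rV (x 0 ord0, tail_rV x) = x.
Proof.
apply/rowP => i; case: (unliftP ord0 i) => [j|] ->.
  by rewrite cons_rVS/= mxE.
by rewrite cons_rV0.
Qed.

Definition box n (a b : 'rV[R]_n) : set 'rV[R]_n :=
  [set x | forall i, a 0 i < x 0 i < b 0 i].

Lemma measurable_box n (a b : 'rV[R]_n) : measurable (box a b).
Proof.
rewrite (_ : box a b =
  \bigcap_(i in setT) [set x : 'rV[R]_n | a 0 i < x 0 i < b 0 i]); last first.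
  by apply/seteqP; split => [x xab i _|x xab i]; [exact: xab|exact: (xab i)].
apply: fin_bigcap_measurable => // i _.
rewrite (_ : mkset _ = (fun x : 'rV[R]_n => x 0 i) @^-1` `]a 0 i, b 0 i[%classic);
  last by apply/seteqP; split => x /=; rewrite in_itv.
rewrite -[X in measurable X]setTI; apply: measurable_coord => //.
Qed.

Lemma cons_rV_box n (a b : 'rV[R]_n.+1) :
  @cons_rV R n @^-1` box a b =
  `]a 0 ord0, b 0 ord0[%classic `*` box (tail_rV a) (tail_rV b).
Proof.
apply/seteqP; split => [[x v] /= h|[x v] /= [h1 h2] i].
  split; first by have := h ord0; rewrite cons_rV0 in_itv.
  by move=> i; have := h (lift ord0 i); rewrite cons_rVS !mxE.
case: (unliftP ord0 i) => [j|] ->.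
  by have := h2 j; rewrite cons_rVS !mxE.
by rewrite cons_rV0; move: h1; rewrite in_itv.
Qed.

Lemma lebesgue_rV_box n (a b : 'rV[R]_n) : (forall i, a 0 i <= b 0 i) ->
  lebesgue_rV R n (box a b) = (\prod_i (b 0 i - a 0 i))%:E.
Proof.
elim: n a b => [|n ih] a b ab /=.
  rewrite big_ord0 diracE mem_set//= => -[] //.
rewrite /cons_measure /pushforward cons_rV_box product_measure2E//; last first.
  exact: measurable_box.
rewrite ih; last by move=> i; rewrite !mxE.
rewrite [X in (X * _)%E](lebesgue_measure_itv `]a 0 ord0, b 0 ord0[)/= lte_fin.
rewrite big_ord_recl; under eq_bigr do rewrite !mxE.
have := ab ord0; rewrite le_eqVlt => /predU1P[->|->] //.
by rewrite ltxx subrr !mul0r mul0e.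
Qed.

Lemma lebesgue_rV_sigma_finite n : sigma_finite setT (lebesgue_rV R n).
Proof.
exists (fun k => box (const_mx (- k%:R)) (const_mx k%:R)).
  apply/seteqP; split => // x _.
  have [k hk] : exists k, forall i, `|x 0 i| < k%:R.
    exists (Num.truncn (\sum_i `|x 0 i|)).+1 => i.
    apply: le_lt_trans (truncnS_gt _).
    by rewrite (bigD1 i)//= lerDl sumr_ge0.
  by exists k => //= i; rewrite !mxE -ltr_norml.
move=> k; split; first exact: measurable_box.
rewrite lebesgue_rV_box ?ltry//.
by move=> i; rewrite !mxE ge0_cp ?ler0n.
Qed.

(** A constant of its own for the recursively defined measure, to which the
    sigma-finiteness that Fubini asks for can be attached. *)
Definition leb n : set 'rV[R]_n -> \bar R := lebesgue_rV R n.

HB.instance Definition _ n := Measure.on (@leb n).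
HB.instance Definition _ n := @Measure_isSigmaFinite.Build _ _ _ (@leb n)
  (@lebesgue_rV_sigma_finite n).

(** The measure in dimension n + 1 is defined as an image of a product measure,
    so that Tonelli applies to it coordinate by coordinate. *)
Lemma ge0_integral_cons n (f : 'rV[R]_n.+1 -> \bar R) :
  measurable_fun setT f -> (forall x, 0 <= f x)%E ->
  (\int[lebesgue_rV R n.+1]_x f x =
   \int[lebesgue_measure]_x \int[lebesgue_rV R n]_v f (cons_rV (x, v)))%E.
Proof.
move=> mf f0 /=.
rewrite /cons_measure ge0_integral_pushforward//; last exact: measurable_cons_rV.
rewrite preimage_setT.
have mfc : measurable_fun setT (f \o @cons_rV R n).
  by apply: measurableT_comp => //; exact: measurable_cons_rV.
rewrite -(@fubini_tonelli1 _ _ _ _ _ lebesgue_measure (@leb n) (f \o @cons_rV R n))//=.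
apply/esym/eq_measure_integral => A mA _.
apply: product_measure_unique => // B C mB mC.
exact: product_measure2E.
Qed.

(** The image of Lebesgue measure under x |-> z + c x, multiplied by c, gives
    every interval its length; there is only one such measure. *)
Lemma ge0_integral_affine (z c : R) (f : R -> \bar R) : 0 < c ->
  measurable_fun setT f -> (forall x, 0 <= f x)%E ->
  (c%:E * \int[lebesgue_measure]_x f (z + c * x)%R =
   \int[lebesgue_measure]_x f x)%E.
Proof.
move=> c0 mf f0.
pose F (x : measurableTypeR R) : measurableTypeR R := z + c * x.
have mF : measurable_fun setT F.
  by apply: measurable_funD => //; exact: measurable_funM.
have nuE A : measurable A -> lebesgue_measure A =
    mscale (NngNum (ltW c0)) (pushforward lebesgue_measure F) A.
  move=> mA; apply: lebesgue_measure_unique => //= _ [[a b] _ <-].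
  rewrite /mscale/= /pushforward.
  rewrite (_ : F @^-1` _ = `](a - z) / c, (b - z) / c]%classic); last first.
    apply/seteqP; split => x /=; rewrite !in_itv/= /F ltr_pdivrMr// ler_pdivlMr//
      [x * c]mulrC.
      by move=> /andP[? ?]; apply/andP; split; lra.
    by move=> /andP[? ?]; apply/andP; split; lra.
  rewrite !lebesgue_measure_itv/= !lte_fin ltr_pM2r ?invr_gt0// ltrD2r.
  case: ifP => _; last by rewrite mule0.
  by rewrite -!EFinD -EFinM; congr (_%:E); field; rewrite gt_eqF.
rewrite -[LHS]/(_ * (\int[lebesgue_measure]_(x in setT) (f \o F) x))%E.
rewrite -[setT](preimage_setT F) -ge0_integral_pushforward//.
rewrite -[c%:E]/((NngNum (ltW c0))%:num%:E) -ge0_integral_mscale//.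
by apply: eq_measure_integral => //= A mA _; exact/esym/nuE.
Qed.

(** Each coordinate contributes one factor c. *)
Lemma ge0_integral_rV_affine n (z : 'rV[R]_n) (c : R) (f : 'rV[R]_n -> \bar R) :
  0 < c -> measurable_fun setT f -> (forall x, 0 <= f x)%E ->
  ((c ^+ n)%:E * \int[lebesgue_rV R n]_x f (z + c *: x)%R =
   \int[lebesgue_rV R n]_x f x)%E.
Proof.
move=> c0; elim: n z f => [|n ih] z f mf f0.
  by rewrite mul1e /=; apply: eq_integral => x _; congr f; apply/rowP => -[].
have mfc : measurable_fun setT (f \o @cons_rV R n).
  by apply: measurableT_comp => //; exact: measurable_cons_rV.
rewrite !ge0_integral_cons//; last first.
  exact: (measurableT_comp mf (measurable_affine_rV z c)).
have consE x v : f (z + c *: cons_rV (x, v)) =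
    f (cons_rV (z 0 ord0 + c * x, tail_rV z + c *: v)).
  congr f; apply/rowP => i; case: (unliftP ord0 i) => [j|] ->.
    by rewrite [RHS]cons_rVS mxE [X in _ + X]mxE cons_rVS !mxE.
  by rewrite [RHS]cons_rV0 mxE [X in _ + X]mxE cons_rV0.
under eq_integral => x _ do under eq_integral => v _ do rewrite consE.
pose G x := (\int[lebesgue_rV R n]_v f (cons_rV (x, v)))%E.
have mG : measurable_fun setT G.
  apply: (@measurable_fun_fubini_tonelli_F _ _ _ _ _ (@leb n) (f \o @cons_rV R n)) => //.
  by move=> x; exact: f0.
have GE (x : R) : ((c ^+ n)%:E * \int[lebesgue_rV R n]_v
    f (cons_rV (x, tail_rV z + c *: v)%R))%E = G x.
  apply: (ih (tail_rV z) (fun v => f (cons_rV (x, v)))) => //.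
  exact: (measurableT_comp mfc (measurable_pair1 x)).
have cn0 : (0 < c ^+ n)%R by rewrite exprn_gt0.
have GE' (x : R) : (\int[lebesgue_rV R n]_v
    f (cons_rV (x, tail_rV z + c *: v)%R))%E = ((c ^- n)%:E * G x)%E.
  by rewrite -GE muleA -EFinM mulVf ?gt_eqF// mul1e.
under eq_integral do rewrite GE'.
rewrite ge0_integralZl//; last 3 first.
- apply: (measurableT_comp mG).
  by apply: measurable_funD => //; exact: measurable_funM.
- by move=> x _; apply: integral_ge0.
- by rewrite lee_fin invr_ge0 ltW.
rewrite exprS muleA -EFinM mulfK ?gt_eqF//.
apply: ge0_integral_affine => //.
by move=> x; apply: integral_ge0.
Qed.

Lemma integral_rV_affine_set n (z : 'rV[R]_n) (c : R) (f : 'rV[R]_n -> \bar R)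
    (A : set 'rV[R]_n) : measurable A ->
  0 < c -> measurable_fun setT f -> (forall x, 0 <= f x)%E ->
  ((c ^+ n)%:E * \int[lebesgue_rV R n]_(x in [set x | A (z + c *: x)%R])
     f (z + c *: x)%R =
   \int[lebesgue_rV R n]_(x in A) f x)%E.
Proof.
move=> mA c0 mf f0.
rewrite (integral_mkcond A) -(@ge0_integral_rV_affine n z c)//.
- by congr (_ * _)%E; rewrite integral_mkcond; apply: eq_integral => x _;
   rewrite !patchE/=; congr (if _ then _ else _); apply/idP/idP; rewrite !inE.
- by apply/(measurable_restrictT _ mA); apply: measurable_funTS.
- by move=> x; rewrite patchE; case: ifP.
Qed.

End lebesgue_rV_fubini.

Section integral_derivative.
Variable R : realType.

Lemma lebesgue_rV_set1 n (x : 'rV[R]_n.+1) : lebesgue_rV R n.+1 [set x] = 0%E.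
Proof.
rewrite /= /cons_measure /pushforward.
have -> : @cons_rV R n @^-1` [set x] = [set x 0 ord0] `*` [set tail_rV x].
  apply/seteqP; split => [[a v] /= <-|[a v] /= [-> ->]]; last exact: cons_rV_tail.
  split; first by rewrite cons_rV0.
  by apply/rowP => j; rewrite mxE cons_rVS.
rewrite product_measure2E//; last exact: measurable_set1_rV.
by rewrite [X in (X * _)%E](@lebesgue_measure_set1 R) mul0e.
Qed.

Lemma cvg_rV (T : Type) (F : set_system T) n (f : T -> 'rV[R]_n) (l : 'rV[R]_n) :
  Filter F -> (forall i, f x 0 i @[x --> F] --> l 0 i) -> f @ F --> l.
Proof.
move=> FF h; apply/cvg_ballP => e e0; near=> x.
split => // i j; rewrite !ord1; move: j; near: x.
apply: filter_forall => j; have /cvg_ballP := h j; exact.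
Unshelve. all: by end_near. Qed.

Lemma integrable_bounded_box n (g : 'rV[R]_n -> R) (K M : R) : 0 <= M ->
  measurable_fun setT g -> (forall x, `|g x| <= K) ->
  (forall x, ~ box (const_mx (- M)) (const_mx M) x -> g x = 0) ->
  (lebesgue_rV R n).-integrable setT (EFin \o g).
Proof.
move=> M0 mg gK g0.
apply/integrableP; split; first exact/measurable_EFinP.
set B := box _ _ in g0.
have mB : measurable B by exact: measurable_box.
have K0 : 0 <= K by apply: le_trans (gK 0).
apply: (@le_lt_trans _ _ (\int[lebesgue_rV R n]_x (K%:E * (\1_B x)%:E))%E).
  apply: ge0_le_integral => //.
  - by apply: measurableT_comp => //; exact/measurable_EFinP.
  - by apply/measurable_EFinP; apply: measurable_funM => //.
  - move=> x _; rewrite /= -EFinM lee_fin indicE.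
    case: (boolP (x \in B)) => [|/negP xB]; first by rewrite mulr1.
    by rewrite g0 ?normr0 ?mulr0//; move=> Bx; apply: xB; rewrite inE.
rewrite ge0_integralZl//; last first.
  by apply/measurable_EFinP.
rewrite integral_indic// setIT lebesgue_rV_box ?ltry//.
by move=> i; rewrite !mxE ge0_cp.
Qed.

Lemma integral_cons n (f : 'rV[R]_n.+1 -> \bar R) :
  (lebesgue_rV R n.+1).-integrable setT f ->
  (\int[lebesgue_rV R n.+1]_x f x =
   \int[lebesgue_measure]_x \int[lebesgue_rV R n]_v f (cons_rV (x, v)))%E /\
  (\int[lebesgue_rV R n.+1]_x f x =
   \int[lebesgue_rV R n]_v \int[lebesgue_measure]_x f (cons_rV (x, v)))%E.
Proof.
move=> fi; have mf := measurable_int _ fi.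
have mfc : measurable_fun setT (f \o @cons_rV R n).
  by apply: measurableT_comp => //; exact: measurable_cons_rV.
have fci : (@lebesgue_measure R \x @leb R n)%E.-integrable setT (f \o @cons_rV R n).
  apply/integrable12ltyP => //.
  case/integrableP : fi => _; rewrite (@ge0_integral_cons R n (abse \o f))//.
    exact: measurableT_comp.
  by move=> x; exact: abse_ge0.
suff H : (\int[lebesgue_rV R n.+1]_x f x = \int[lebesgue_measure \x @leb R n]_x
    (f \o @cons_rV R n) x)%E.
  by rewrite H -{1}(integral12_prod_meas1 fci) -(integral21_prod_meas1 fci).
rewrite integralE [RHS]integralE (funepos_comp f (@cons_rV R n)).
rewrite (funeneg_comp f (@cons_rV R n)); congr (_ - _)%E.
  rewrite ge0_integral_cons//; last exact: measurable_funepos.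
  rewrite fubini_tonelli1//; first by rewrite -funepos_comp; exact: measurable_funepos.
  by move=> x /=; exact: funepos_ge0.
rewrite ge0_integral_cons//; last exact: measurable_funeneg.
rewrite fubini_tonelli1//; first by rewrite -funeneg_comp; exact: measurable_funeneg.
  by move=> x /=; exact: funeneg_ge0.
Qed.

(** The fundamental theorem of calculus on an interval outside of which h
    vanishes. *)
Lemma line_integral_eq0 (h g : R -> R) (M : R) : 0 < M ->
  (forall x : R, is_derive x 1 h (g x)) -> continuous g ->
  (forall x, M <= `|x| -> h x = 0 /\ g x = 0) ->
  (\int[lebesgue_measure]_x (g x)%:E = 0)%E.
Proof.
move=> M0 hg cg h0.
have ch : continuous h.
  move=> x; apply/differentiable_continuous/derivable1_diffP.
  exact: (@ex_derive _ _ _ _ _ _ _ (hg x)).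
transitivity (\int[lebesgue_measure]_(x in `[(- M)%R, M]) (g x)%:E)%E.
  rewrite [RHS]integral_mkcond; apply: eq_integral => x _.
  rewrite patchE; case: ifPn => // /negP xM.
  rewrite (h0 x _).2//; apply/ltW; rewrite ltNge; apply/negP => xM'; apply: xM.
  by rewrite inE /= in_itv/= -ler_norml.
rewrite (@continuous_FTC2 _ g h)//.
- by rewrite (h0 M _).1 ?(h0 (- M) _).1 ?sube0// ?normrN ger0_norm// ltW.
- by lra.
- exact: continuous_subspaceT.
- split; first by move=> x _; exact: (@ex_derive _ _ _ _ _ _ _ (hg x)).
    by apply: cvg_at_right_filter; exact: ch.
  by apply: cvg_at_left_filter; exact: ch.
- by move=> x _; rewrite derive1E; exact: (@derive_val _ _ _ _ _ _ _ (hg x)).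
Qed.

(** Reduces a partial derivative to the derivative of a function of one
    variable. *)
Lemma is_derive_dirP (V W : normedModType R) (f : V -> W) (x v : V) (l : W) :
  is_derive x v f l <-> is_derive (0 : R) 1 (fun t : R => f (t *: v + x)) l.
Proof.
have E (t : R) : (fun h : R => h^-1 *: ((f \o shift x) (h *: v) - f x)) =
   (fun h : R => h^-1 *: (((fun t : R => f (t *: v + x)) \o shift 0) (h *: 1) -
      (fun t : R => f (t *: v + x)) 0)).
  by apply/funext => h /=; rewrite addr0 scale0r add0r [h *: 1]mulr1.
split=> -[dx dl]; split; move: dx dl; rewrite /derivable /derive (E 0)//.
Qed.

Lemma cons_rV_continuousr n (x : R) : continuous (fun v : 'rV[R]_n => cons_rV (x, v)).
Proof.
move=> v; apply: (@cvg_rV _ _ _ _ _ (nbhs_filter v)) => i.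
case: (unliftP ord0 i) => [j|] ->.
  by under eq_fun do rewrite cons_rVS/=; rewrite cons_rVS; exact: coord_continuous.
by under eq_fun do rewrite cons_rV0/=; rewrite cons_rV0; exact: cvg_cst.
Qed.

Lemma cons_rV_continuousl n (v : 'rV[R]_n) : continuous (fun x : R => cons_rV (x, v)).
Proof.
move=> x; apply: (@cvg_rV _ _ _ _ _ (nbhs_filter x)) => i.
case: (unliftP ord0 i) => [j|] ->.
  by under eq_fun do rewrite cons_rVS/=; rewrite cons_rVS; exact: cvg_cst.
by under eq_fun do rewrite cons_rV0/=; rewrite cons_rV0; exact: cvg_id.
Qed.

Lemma cons_rV_addh n (t x : R) (v : 'rV[R]_n) :
  cons_rV (t + x, v) = t *: delta_mx 0 ord0 + cons_rV (x, v).
Proof.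
apply/rowP => i; case: (unliftP ord0 i) => [j|] ->.
  by rewrite cons_rVS [RHS]mxE cons_rVS !mxE eqxx/= mulr0 add0r.
by rewrite cons_rV0 [RHS]mxE cons_rV0 !mxE eqxx/= mulr1.
Qed.

Lemma cons_rV_addt n (t x : R) (v : 'rV[R]_n) i :
  cons_rV (x, t *: delta_mx 0 i + v) = t *: delta_mx 0 (lift ord0 i) + cons_rV (x, v).
Proof.
apply/rowP => k; case: (unliftP ord0 k) => [j|] ->.
  by rewrite cons_rVS [RHS]mxE cons_rVS !mxE (inj_eq lift_inj).
by rewrite cons_rV0 [RHS]mxE cons_rV0 !mxE eqxx/= mulr0 add0r.
Qed.

(** By Fubini the direction of differentiation can be integrated first, along
    lines on which the integral of the derivative vanishes. *)
Lemma integral_directional_derivative n (h g : 'rV[R]_n -> R) i (K M : R) :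
  0 < M ->
  (forall x : 'rV[R]_n, is_derive x (delta_mx 0 i : 'rV[R]_n) h (g x)) ->
  continuous g -> (forall x, `|g x| <= K) ->
  (forall x, ~ box (const_mx (- M)) (const_mx M) x -> h x = 0 /\ g x = 0) ->
  (\int[lebesgue_rV R n]_x (g x)%:E = 0)%E.
Proof.
move=> M0; elim: n h g i => [|n ih] h g i hg cg gK h0; first by case: i hg => -[].
have mg := continuous_measurable_rV cg.
have gi : (lebesgue_rV R n.+1).-integrable setT (EFin \o g).
  by apply: (@integrable_bounded_box _ _ K M) => //; [exact: ltW|move=> x /h0[]].
have [I1 I2] := integral_cons gi.
case: (unliftP ord0 i) => [j|] ij; rewrite ij in hg.
  rewrite [LHS]I1; apply: integral0_eq => x _ /=.
  apply: (ih (fun v => h (cons_rV (x, v))) (fun v => g (cons_rV (x, v))) j) => //.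
  - move=> v; apply/is_derive_dirP.
    under eq_fun do rewrite cons_rV_addt.
    exact: (@is_derive_dirP _ _ h _ _ _).1 (hg _).
  - move=> v; apply: (@continuous_comp _ _ _ (fun v => cons_rV (x, v)) g).
      exact: cons_rV_continuousr.
    exact: cg.
  - move=> v nv; apply: h0 => bv; apply: nv => k.
    by have := bv (lift ord0 k); rewrite cons_rVS !mxE.
rewrite [LHS]I2; apply: integral0_eq => v _ /=.
apply: (@line_integral_eq0 (fun x => h (cons_rV (x, v)))
  (fun x => g (cons_rV (x, v))) M) => //.
- move=> x; apply/is_derive_dirP.
  under eq_fun do rewrite [_ *: (1 : R)]mulr1 cons_rV_addh.
  exact: (@is_derive_dirP _ _ h _ _ _).1 (hg _).
- move=> x; apply: (@continuous_comp _ _ _ (fun x => cons_rV (x, v)) g).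
    exact: cons_rV_continuousl.
  exact: cg.
- move=> x Mx; apply: h0 => bx.
  have := bx ord0; rewrite cons_rV0 !mxE/= -ltr_norml ltNge => /negP; exact.
Qed.

End integral_derivative.

(** * Smooth bumps and the fundamental lemma of the calculus of variations *)

Section flat_functions.
Variable R : realType.

(** The exponential series dominates every monomial: y^i <= i! exp y. *)
Lemma poly_expRN_bounded (p : {poly R}) :
  exists2 K, 0 <= K & forall y, 0 <= y -> `|p.[y]| * expR (- y) <= K.
Proof.
elim/poly_ind: p => [|p c _]; first by exists 0 => // y _; rewrite horner0 normr0 mul0r.
set q := _ + _; exists (\sum_(i < size q) `|q`_i| * i`!%:R).
  by apply: sumr_ge0 => i _; rewrite mulr_ge0.
move=> y y0; rewrite horner_coef.
apply: (@le_trans _ _ ((\sum_(i < size q) `|q`_i * y ^+ i|) * expR (- y))).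
  by rewrite ler_wpM2r ?expR_ge0// ler_norm_sum.
rewrite mulr_suml; apply: ler_sum => i _.
rewrite normrM -mulrA ler_wpM2l// ger0_norm ?exprn_ge0//.
rewrite expRN ler_pdivrMr ?expR_gt0//.
case: (nat_of_ord i) => [|n].
  by rewrite expr0 mul1r; apply: le_trans (expR_ge1Dx _); rewrite lerDl.
have := expR_ge1Dxn n y0.
rewrite -ler_pdivrMl ?ltr0n ?fact_gt0// mulrC.
by apply: le_trans; rewrite lerDr.
Qed.

(** The function p (1 / y) exp (- 1 / y), extended by 0. Differentiation maps the
    family indexed by p into itself, so a single computation of a derivative
    shows that all its members are smooth. *)
Definition flat (p : {poly R}) (y : R) : R :=
  if 0 < y then p.[y^-1] * expR (- y^-1) else 0.

(** Applied to X p, this bound gives the limit at 0 of the difference quotient of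
    flat p. *)
Lemma flat_le (p : {poly R}) : exists2 K, 0 <= K & forall y, `|flat p y| <= K * `|y|.
Proof.
have [K K0 hK] := poly_expRN_bounded ('X * p).
exists K => // y; rewrite /flat; case: ifPn => [y0|_]; last by rewrite normr0 mulr_ge0.
have := hK y^-1 _; rewrite invr_ge0 => /(_ (ltW y0)).
rewrite hornerM hornerX !normrM (gtr0_norm y0).
rewrite (@gtr0_norm _ (y^-1)) ?invr_gt0// (@ger0_norm _ (expR _)) ?expR_ge0//.
by rewrite -mulrA ler_pdivrMl// [y * _]mulrC.
Qed.

Lemma flat_derive (p : {poly R}) (y : R) :
  is_derive y 1 (flat p) (flat ('X^2 * (p - p^`())) y).
Proof.
have [y0|y0|y0] := ltgtP 0 y.
- apply: (@near_eq_is_derive R R R (fun y : R => p.[y^-1] * expR (- y^-1)) (flat p) y 1).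
    near=> z; rewrite /flat ifT//; near: z; exact: lt_nbhsr.
  rewrite /flat y0.
  have dV : is_derive y 1 (fun z : R => z^-1) (- y ^- 2 *: 1).
    by apply: is_deriveV; rewrite gt_eqF.
  have dp : is_derive y 1 (fun z : R => p.[z^-1]) (p^`().[y^-1] * (- y ^- 2 *: 1)).
    apply: (@is_derive1_comp _ (horner p) (fun z : R => z^-1)) => //.
  have de : is_derive y 1 (fun z : R => expR (- z^-1))
      (expR (- y^-1) * (- (- y ^- 2 *: 1))).
    exact: (@is_derive1_comp _ expR (fun z : R => - z^-1)).
  apply: (is_derive_eq (is_deriveM dp de)).
  rewrite /= hornerM hornerXn hornerD hornerN /GRing.scale/=.
  by field; rewrite gt_eqF.
- apply: (@near_eq_is_derive R R R (cst 0) (flat p) y 1).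
    near=> z; rewrite /flat ifF//; apply/negbTE; rewrite -leNgt.
    by near: z; apply: filterS (lt_nbhsl y0) => z /ltW.
  by rewrite /flat ifF ?ltNge ?(ltW y0)//; exact: (is_derive_cst (0 : R)).
- subst y; rewrite {2}/flat ltxx; apply/is_derive1_caratheodory.
  exists (flat ('X * p)); split.
  + move=> z; rewrite /flat ltxx subr0 subr0; case: ifPn => z0; last by rewrite mul0r.
    by rewrite hornerM hornerX; field; rewrite gt_eqF.
  + have [K K0 hK] := flat_le ('X * p).
    apply/cvgrPdist_le => e e0; near=> z.
    rewrite {1}/flat ltxx sub0r normrN (le_trans (hK z))//.
    have : `|z| <= e / (K + 1).
      near: z; apply: (@nbhs0_le R R).
      by rewrite divr_gt0// ltr_wpDl.
    rewrite ler_pdivlMr ?ltr_wpDl// => h; apply: le_trans h.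
    by rewrite [K * _]mulrC ler_wpM2l// lerDl.
  + by rewrite /flat ltxx.
Unshelve. all: by end_near. Qed.

End flat_functions.

Section smooth_functions.
Variables (R : realType) (n : nat).
Implicit Types f g : 'rV[R]_n -> R.

(** A class of functions of several variables that partial derivatives map into
    itself; its members are smooth because each of them is differentiable. *)
Inductive flat_algebra : ('rV[R]_n -> R) -> Prop :=
| flat_algebra_cst c : flat_algebra (cst c)
| flat_algebra_flat p s c i : flat_algebra (fun x => flat p (s * x 0 i + c))
| flat_algebraD f g : flat_algebra f -> flat_algebra g -> flat_algebra (f + g)
| flat_algebraM f g : flat_algebra f -> flat_algebra g -> flat_algebra (f * g).

Lemma differentiable_affine_coord s c (i : 'I_n) (x : 'rV[R]_n) :
  differentiable (fun y : 'rV[R]_n => s * y 0 i + c) x.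
Proof.
apply: (@differentiableD R _ _ (fun y : 'rV[R]_n => s * y 0 i) (cst c)) => //.
apply: (@differentiableM R _ (cst s) (fun y : 'rV[R]_n => y 0 i)) => //.
exact: differentiable_coord.
Qed.

Lemma flat_algebra_differentiable f x : flat_algebra f -> differentiable f x.
Proof.
elim=> [c|p s c i|f1 g1 _ f1d _ g1d|f1 g1 _ f1d _ g1d].
- exact: differentiable_cst.
- apply: (@differentiable_comp R _ _ _ (fun y : 'rV[R]_n => s * y 0 i + c) (flat p)).
    exact: differentiable_affine_coord.
  apply/derivable1_diffP; exact: (@ex_derive _ _ _ _ _ _ _ (flat_derive p _)).
- exact: differentiableD.
- exact: differentiableM.
Qed.

Lemma is_derive_coord_comp (h : R -> R) (h' s c : R) (x : 'rV[R]_n) i j :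
  is_derive (s * x 0 i + c) 1 h h' ->
  is_derive x (delta_mx 0 j : 'rV[R]_n) (fun y : 'rV[R]_n => h (s * y 0 i + c))
    ((s *+ (i == j)) * h').
Proof.
move=> hh; apply/is_derive_dirP.
under eq_fun do rewrite !mxE eqxx/=.
have E (t : R) : s * (t * (i == j)%:R + x 0 i) + c =
    (s *+ (i == j)) * t + (s * x 0 i + c).
  by case: eqP => _; rewrite ?mulr1n ?mulr0n; ring.
under eq_fun do rewrite E.
rewrite [_ * h']mulrC.
apply: (@is_derive1_comp _ h (fun t : R => s *+ (i == j) * t + (s * x 0 i + c))).
  by rewrite mulr0 add0r.
apply: (is_derive_eq (is_deriveD (is_deriveM (is_derive_cst (s *+ (i == j)) (0 : R) 1)
  (is_derive_id (0 : R) 1)) (is_derive_cst (s * x 0 i + c) (0 : R) 1))).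
by rewrite scaler0 addr0 addr0 /GRing.scale/= mulr1.
Qed.

Lemma flat_algebra_partial f j : flat_algebra f ->
  exists2 g, flat_algebra g &
    forall x : 'rV[R]_n, is_derive x (delta_mx 0 j : 'rV[R]_n) f (g x).
Proof.
elim=> [c|p s c i|f1 g1 f1a [f2 f2a f2d] g1a [g2 g2a g2d]
        |f1 g1 f1a [f2 f2a f2d] g1a [g2 g2a g2d]].
- by exists (cst 0); [exact: flat_algebra_cst|move=> x; exact: is_derive_cst].
- exists (cst (s *+ (i == j)) * (fun x : 'rV[R]_n =>
    flat ('X^2 * (p - p^`())) (s * x 0 i + c))).
    by apply: flat_algebraM; [exact: flat_algebra_cst|exact: flat_algebra_flat].
  by move=> x; apply: is_derive_coord_comp; exact: flat_derive.
- exists (f2 + g2); first exact: flat_algebraD.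
  by move=> x; exact: is_deriveD.
- exists (f1 * g2 + g1 * f2).
    by apply: flat_algebraD; exact: flat_algebraM.
  by move=> x; exact: is_deriveM.
Qed.

Lemma flat_algebra_smooth f : flat_algebra f -> smooth f.
Proof.
move=> fa s x; apply: flat_algebra_differentiable.
elim: s => [//|j s ih] /=.
have [g ga gd] := flat_algebra_partial j ih.
rewrite [partial _ _](_ : _ = g)//; apply/funext => y.
exact: (@derive_val _ _ _ _ _ _ _ (gd y)).
Qed.

Lemma flat_algebra_prod (I : Type) (r : seq I) (F : I -> 'rV[R]_n -> R) :
  (forall i, flat_algebra (F i)) -> flat_algebra (fun x => \prod_(i <- r) F i x).
Proof.
move=> Fa; elim: r => [|i r ih].
  by under eq_fun do rewrite big_nil; exact: flat_algebra_cst.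
by under eq_fun do rewrite big_cons; exact: (flat_algebraM (Fa i) ih).
Qed.

End smooth_functions.

Section bump.
Variables (R : realType) (n : nat).
Implicit Types (a b x : 'rV[R]_n).

Definition cbox a b : set 'rV[R]_n := [set x | forall i, a 0 i <= x 0 i <= b 0 i].

Lemma box_sub_cbox a b : box a b `<=` cbox a b.
Proof. by move=> x abx i; have /andP[/ltW-> /ltW->] := abx i. Qed.

Lemma compact_cbox a b : compact (cbox a b).
Proof.
rewrite (_ : cbox a b = [set v | forall i, `[a 0 i, b 0 i]%classic (v 0 i)]).
  exact: (@rV_compact R n (fun i => `[a 0 i, b 0 i]%classic)
    (fun i => @segment_compact R _ _)).
by apply/seteqP; split => x h i; have := h i; rewrite /= in_itv.
Qed.

Lemma closed_cbox a b : closed (cbox a b).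
Proof.
apply: compact_closed; [exact: norm_hausdorff|exact: compact_cbox].
Qed.

Lemma measurable_cbox a b : measurable (cbox a b).
Proof. by apply: measurable_compact_rV; exact: compact_cbox. Qed.

(** The factor exp (- 1 / (k y)) increases to 1 for y > 0, so these functions
    approach the indicator of the open box as k grows. *)
Definition bump (k : nat) a b x : R :=
  \prod_(i < n) (flat 1 (k.+1%:R * (x 0 i - a 0 i)) * flat 1 (k.+1%:R * (b 0 i - x 0 i))).

Lemma flat1_itv01 (y : R) : 0 <= flat 1 y <= 1.
Proof.
rewrite /flat; case: ifPn => y0; last by rewrite lexx ler01.
rewrite hornerC mul1r expR_ge0 -expR0 ler_expR oppr_le0 invr_ge0 ltW//.
Qed.

Lemma bump_itv01 k a b x : 0 <= bump k a b x <= 1.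
Proof.
rewrite /bump; elim/big_ind : _ => [|u v|i _]; first by rewrite ler01 lexx.
  move=> /andP[u0 u1] /andP[v0 v1]; rewrite mulr_ge0//=.
  by rewrite mulr_ile1.
have /andP[u0 u1] := flat1_itv01 (k.+1%:R * (x 0 i - a 0 i)).
have /andP[v0 v1] := flat1_itv01 (k.+1%:R * (b 0 i - x 0 i)).
by rewrite mulr_ge0//= mulr_ile1.
Qed.

Lemma bump_eq0 k a b x : ~ box a b x -> bump k a b x = 0.
Proof.
move=> /existsNP[i /negP nx]; rewrite /bump (bigD1 i)//=.
have [ax|ax] := ltP (a 0 i) (x 0 i); last first.
  by rewrite {1}/flat pmulr_rgt0// subr_gt0 ltNge ax/= !mul0r.
move: nx; rewrite ax/= => bx.
by rewrite {2}/flat pmulr_rgt0// subr_gt0 (negbTE bx) mulr0 mul0r.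
Qed.

Lemma bump_test_function k a b : test_function (bump k a b).
Proof.
split.
  apply: flat_algebra_smooth; apply: flat_algebra_prod => i.
  apply: (@flat_algebraM _ _ (fun x => flat 1 (k.+1%:R * (x 0 i - a 0 i)))
    (fun x => flat 1 (k.+1%:R * (b 0 i - x 0 i)))).
    rewrite (_ : (fun x => _) = fun x => flat 1 (k.+1%:R * x 0 i + - (k.+1%:R * a 0 i))).
      exact: flat_algebra_flat.
    by apply/funext => x; rewrite mulrBr.
  rewrite (_ : (fun x => _) = fun x => flat 1 (- k.+1%:R * x 0 i + k.+1%:R * b 0 i)).
    exact: flat_algebra_flat.
  by apply/funext => x; rewrite mulrBr addrC mulNr.
apply: (subclosed_compact _ (@compact_cbox a b)); first exact: closed_closure.
rewrite [X in _ `<=` X]((closure_id _).1 (@closed_cbox a b)).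
apply: closureS => x /= /eqP x0; apply: box_sub_cbox.
by apply: contrapT => /bump_eq0.
Qed.

Lemma cvg_flat1 (y : R) : 0 < y -> flat 1 (k.+1%:R * y) @[k --> \oo] --> (1 : R).
Proof.
move=> y0.
have -> : (fun k => flat 1 (k.+1%:R * y)) = (fun k => expR (- (y^-1 * k.+1%:R^-1))).
  apply/funext => k; rewrite /flat pmulr_rgt0// y0 hornerC mul1r.
  by rewrite invfM mulrC.
rewrite [X in _ --> X](_ : 1 = expR (- (y^-1 * 0))); last by rewrite mulr0 oppr0 expR0.
apply: continuous_cvg; first exact: continuous_expR.
by apply: cvgN; apply: cvgMr; exact: cvg_harmonic.
Qed.

Lemma cvg_bump a b x : bump k a b x @[k --> \oo] --> (\1_(box a b) x : R).
Proof.
rewrite indicE; have [abx|nabx] := pselect (box a b x); last first.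
  rewrite (memNset nabx); apply: cvg_near_cst.
  by apply: nearW => k; rewrite bump_eq0.
rewrite mem_set//= /bump.
rewrite [X in _ --> X](_ : _ = \prod_(i < n) (1 * 1)); last first.
  by rewrite big1// => i _; rewrite mulr1.
apply: cvg_big => [|i _]; first exact: mul_continuous.
by have /andP[ax xb] := abx i; apply: cvgM; apply: cvg_flat1; rewrite subr_gt0.
Qed.

End bump.

Section boxes_generate.
Variables (R : realType) (n : nat).

Definition boxes : set (set 'rV[R]_n) := [set A | exists a b, A = box a b].

Lemma boxes_measurable : boxes `<=` measurable.
Proof. by move=> _ [a [b ->]]; exact: measurable_box. Qed.

Lemma setI_closed_boxes : setI_closed boxes.
Proof.
move=> _ _ [a [b ->]] [a' [b' ->]].
exists (\row_i Num.max (a 0 i) (a' 0 i)), (\row_i Num.min (b 0 i) (b' 0 i)).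
apply/seteqP; split => [x [abx abx'] i|x h].
  by rewrite !mxE gt_max lt_min; have /andP[-> ->] := abx i; have /andP[-> ->] := abx' i.
by split => i; have := h i; rewrite !mxE gt_max lt_min => /andP[/andP[p1 p2] /andP[p3 p4]];
  apply/andP.
Qed.

Lemma measurable_boxes (A : set 'rV[R]_n) : measurable A -> <<s boxes >> A.
Proof.
apply: smallest_sub; first exact: smallest_sigma_algebra.
move=> U oU; rewrite (open_mx_rbox oU) bigcup_mkcond.
pose T : measurableType _ := g_sigma_algebraType boxes.
apply: (@countable_bigcupT_measurable _ T) => // c; case: ifPn => _; last first.
  exact: (@measurable0 _ T).
apply: sub_sigma_algebra.
exists (\row_j (ratr (c.1 0 j) - c.2.+1%:R^-1)), (\row_j (ratr (c.1 0 j) + c.2.+1%:R^-1)).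
apply/seteqP; split => [x h j|x h i _ j _].
  by have := h 0 I j I; rewrite /= ball_itv/= in_itv/= !mxE.
by have := h j; rewrite /= ball_itv/= in_itv/= (ord1 i) !mxE.
Qed.

Definition ncube (k : nat) : set 'rV[R]_n := box (const_mx (- k%:R)) (const_mx k%:R).

Lemma ncube_cover : \bigcup_k ncube k = setT.
Proof.
apply/seteqP; split => // x _.
exists (Num.truncn (\sum_i `|x 0 i|)).+1 => // i; rewrite !mxE -ltr_norml.
apply: le_lt_trans (truncnS_gt _).
by rewrite (bigD1 i)//= lerDl sumr_ge0.
Qed.

End boxes_generate.

Section density_measure.
Local Open Scope ereal_scope.
Context d (T : measurableType d) (R : realType) (mu : {measure set T -> \bar R}).
Variables (f : T -> \bar R) (mf : measurable_fun setT f) (f0 : forall x, 0 <= f x).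

Definition density_measure (A : set T) : \bar R := \int[mu]_(x in A) f x.

Let density_measure0 : density_measure set0 = 0.
Proof. exact: integral_set0. Qed.

Let density_measure_ge0 A : 0 <= density_measure A.
Proof. exact: integral_ge0. Qed.

Let density_measure_sigma_additive : semi_sigma_additive density_measure.
Proof.
move=> F mF tF mUF; rewrite /density_measure ge0_integral_bigcup//; last first.
  exact: measurable_funTS.
by apply: is_cvg_ereal_nneg_natsum_cond => k _ _; exact: integral_ge0.
Qed.

HB.instance Definition _ := isMeasure.Build _ _ _ density_measure
  density_measure0 density_measure_ge0 density_measure_sigma_additive.

Definition density_meas : {measure set T -> \bar R} := density_measure.

End density_measure.

Section fundamental_lemma.
Variables (R : realType) (n : nat) (g : 'rV[R]_n -> R).
Hypothesis g_loc : loc_integrable g.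

Let mg : measurable_fun setT g. Proof. exact: g_loc.1. Qed.

Lemma loc_integrable_cbox a b : (lebesgue_rV R n).-integrable (cbox a b) (EFin \o g).
Proof.
apply/integrableP; split; first exact/measurable_EFinP/measurable_funTS.
exact: (g_loc.2 _ (@compact_cbox R n a b)).
Qed.

Lemma loc_integrable_box a b : (lebesgue_rV R n).-integrable (box a b) (EFin \o g).
Proof.
apply: (integrableS _ _ (@box_sub_cbox R n a b) (loc_integrable_cbox a b)).
  exact: measurable_cbox.
exact: measurable_box.
Qed.

Hypothesis g_test : forall phi, test_function phi ->
  \int[lebesgue_rV R n]_x (g x * phi x) = 0.

Lemma measurable_bump k (a b : 'rV[R]_n) : measurable_fun setT (bump k a b).
Proof.
apply: continuous_measurable_rV => x.
apply: differentiable_continuous.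
exact: ((bump_test_function k a b).1 [::]).
Qed.

(** The bumps are admissible test functions; dominated convergence replaces them
    by the indicator of the box. *)
Lemma integral_box_eq0 a b : (\int[lebesgue_rV R n]_(x in box a b) (g x)%:E = 0)%E.
Proof.
set mu := lebesgue_rV R n.
pose F k x := (g x * bump k a b x)%:E.
have mF k : measurable_fun setT (F k).
  by apply/measurable_EFinP; apply: measurable_funM => //; exact: measurable_bump.
have iF k : mu.-integrable setT (F k).
  have ibox : mu.-integrable setT ((EFin \o g) \_ (box a b)).
    by apply/(integrable_mkcond _ (measurable_box a b)); exact: loc_integrable_box.
  apply: (le_integrable _ (mF k) _ ibox) => // x _.
  rewrite patchE; case: ifPn => [_|]; last first.
    by rewrite notin_setE => /bump_eq0 h; rewrite /F h mulr0.
  have /andP[b0 b1] := bump_itv01 k a b x.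
  by rewrite /= /F normrM lee_fin ler_piMr// ger0_norm.
have F0 k : (\int[mu]_(x in box a b) F k x = 0)%E.
  transitivity (\int[mu]_x F k x)%E.
    rewrite integral_mkcond; apply: eq_integral => x _.
    rewrite patchE; case: ifPn => [//|]; rewrite notin_setE => /bump_eq0 h.
    by rewrite /F h mulr0.
  have /integral_fune_fin_num := iF k; move/(_ measurableT)/fineK => <-.
  by rewrite -[fine _]/(Rintegral _ _ _) g_test//; exact: bump_test_function.
have [] := @dominated_convergence _ _ _ mu _ (measurable_box a b) F
    (EFin \o g) (abse \o (EFin \o g)) _ _ _ _ _.
- by move=> k; exact: measurable_funTS.
- exact/measurable_funTS/measurable_EFinP.
- apply: nearW => x abx; apply: cvg_EFin; first exact: nearW.
  have -> : g x = g x * 1 by rewrite mulr1.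
  apply: cvgMr; have := @cvg_bump R n a b x.
  by rewrite indicE mem_set.
- exact/integrable_norm/loc_integrable_box.
- apply: nearW => x k abx.
  have /andP[b0 b1] := bump_itv01 k a b x.
  by rewrite /= /F normrM lee_fin ler_piMr// ger0_norm.
move=> _ _; rewrite [X in X @ _ --> _](_ : _ = cst 0%E).
  by move=> /cvg_lim; rewrite lim_cst// => ->.
by apply/funext => k; exact: F0.
Qed.

(** The positive and the negative part of g are densities of measures that agree
    on boxes; boxes are stable under intersection and generate the Borel sets. *)
Lemma integral_funepos_funeneg (A : set 'rV[R]_n) : measurable A ->
  (\int[lebesgue_rV R n]_(x in A) (EFin \o g)^\+ x =
   \int[lebesgue_rV R n]_(x in A) (EFin \o g)^\- x)%E.
Proof.
have mge : measurable_fun setT (EFin \o g) by exact/measurable_EFinP.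
have mp := measurable_funepos mge; have mn := measurable_funeneg mge.
move=> /measurable_boxes.
have fin a b : (\int[lebesgue_rV R n]_(x in box a b) (EFin \o g)^\+ x < +oo)%E.
  rewrite -ge0_fin_numE; last exact: integral_ge0.
  exact: (integrable_pos_fin_num (@measurable_box R n a b) (loc_integrable_box a b)).
apply: (g_sigma_algebra_measure_unique (@boxes R n) (@boxes_measurable R n)
  (@ncube R n) _ (@ncube_cover R n) (density_meas _ mp (@funepos_ge0 _ _ _))
  (density_meas _ mn (@funeneg_ge0 _ _ _))).
- by move=> k; exists (const_mx (- k%:R)), (const_mx k%:R).
- exact: setI_closed_boxes.
- move=> _ [a [b ->]]; rewrite /= /density_measure.
  have fn := integrable_neg_fin_num (@measurable_box R n a b) (loc_integrable_box a b).
  have h := integral_box_eq0 a b; rewrite integralE in h.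
  by rewrite -[LHS](subeK _ fn) h add0e.
- by move=> k; exact: fin.
Qed.

(** On the set where g is positive its negative part vanishes, hence so does the
    integral of its positive part; likewise with the signs exchanged. *)
Lemma fundamental_lemma_variations : {ae lebesgue_rV R n, forall x, g x = 0}.
Proof.
have mge : measurable_fun setT (EFin \o g) by exact/measurable_EFinP.
have mp := measurable_funepos mge; have mn := measurable_funeneg mge.
set mu := lebesgue_rV R n.
have mpos : measurable [set x | 0 < g x].
  rewrite -[X in measurable X]setTI; rewrite (_ : mkset _ = g @^-1` `]0, +oo[).
    exact: mg.
  by apply/seteqP; split => x /=; rewrite in_itv/= andbT.
have mneg : measurable [set x | g x < 0].
  rewrite -[X in measurable X]setTI; rewrite (_ : mkset _ = g @^-1` `]-oo, 0[).
    exact: mg.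
  by apply/seteqP; split => x /=; rewrite in_itv.
have nnpos : ae_eq mu [set x | 0 < g x] (EFin \o g)^\+%E (cst 0%E).
  apply/ae_eq_integral_abs => //; first exact: measurable_funTS.
  under eq_integral do rewrite gee0_abs//.
  rewrite integral_funepos_funeneg//; apply: integral0_eq => x /= gx.
  by rewrite funenegE/= max_r// lee_fin oppr_le0 ltW.
have nnneg : ae_eq mu [set x | g x < 0] (EFin \o g)^\-%E (cst 0%E).
  apply/ae_eq_integral_abs => //; first exact: measurable_funTS.
  under eq_integral do rewrite gee0_abs//.
  rewrite -integral_funepos_funeneg//; apply: integral0_eq => x /= gx.
  by rewrite funeposE/= max_r// lee_fin ltW.
move: nnpos nnneg; apply: filterS2 => x h1 h2.
have [gx|gx|//] := ltgtP (g x) 0.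
  have := h2 gx; rewrite funenegE/= max_l ?lee_fin ?oppr_ge0 ?ltW//.
  by move=> [/eqP]; rewrite oppr_eq0 lt_eqF.
have := h1 gx; rewrite funeposE/= max_l ?lee_fin ?ltW//.
by move=> [/eqP]; rewrite gt_eqF.
Qed.

End fundamental_lemma.

(** * Weak gradients *)

Section continuous_rV.
Variables (R : realType) (n : nat).
Implicit Types f g : 'rV[R]_n -> R.

Lemma compact_sub_box (K : set 'rV[R]_n) : compact K ->
  exists2 M : R, 0 < M & K `<=` box (const_mx (- M)) (const_mx M).
Proof.
move=> /compact_bounded [M0 [_ hM]].
exists (`|M0| + 1) => [|x Kx i]; first by rewrite ltr_pwDr.
have := hM (`|M0| + 2^-1) _ x Kx => xM.
have {}xM : `|x| <= `|M0| + 2^-1.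
  by apply: xM; rewrite (le_lt_trans (ler_norm _))// ltrDl invr_gt0.
rewrite !mxE -ltr_norml; apply: (@le_lt_trans _ _ `|x|).
  rewrite [leRHS]/Num.norm/= mx_normE.
  exact: (le_bigmax _ (fun i : 'I_1 * 'I_n => `|x i.1 i.2|%:nng) (0, i)).
by apply: le_lt_trans xM _; rewrite ltrD2l invf_lt1// ltr1n.
Qed.

Lemma continuous_bounded_on (K : set 'rV[R]_n) f : continuous f -> compact K ->
  exists2 M : R, 0 <= M & forall x, K x -> `|f x| <= M.
Proof.
move=> cf cK; have /compact_bounded [M0 [_ hM]] :=
  continuous_compact (continuous_subspaceT cf) cK.
exists (`|M0| + 1) => [|x Kx]; first by rewrite addr_ge0.
have M1 : M0 < `|M0| + 1 by rewrite (le_lt_trans (ler_norm _))// ltrDl.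
by apply: (hM _ M1); exists x.
Qed.

Lemma lebesgue_rV_compact (K : set 'rV[R]_n) : compact K ->
  (lebesgue_rV R n K < +oo)%E.
Proof.
move=> cK; have [M M0 KM] := compact_sub_box cK.
have mK := measurable_compact_rV cK.
apply: (@le_lt_trans _ _ (lebesgue_rV R n (box (const_mx (- M)) (const_mx M)))).
  by apply: le_measure => //; rewrite inE//; exact: measurable_box.
by rewrite lebesgue_rV_box ?ltry// => i; rewrite !mxE; lra.
Qed.

Lemma continuous_loc_integrable f : continuous f -> loc_integrable f.
Proof.
move=> cf; have mf := continuous_measurable_rV cf; split=> // K cK.
have [M M0 fM] := continuous_bounded_on cf cK.
have mK := measurable_compact_rV cK.
apply: (@le_lt_trans _ _ (\int[lebesgue_rV R n]_(x in K) M%:E)%E).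
  apply: ge0_le_integral => //.
  exact/measurable_EFinP/measurable_funTS/measurableT_comp.
rewrite integral_cst//; apply: lte_mul_pinfty => //.
exact: lebesgue_rV_compact.
Qed.

Lemma is_derive_partial f x i : differentiable f x ->
  is_derive x (delta_mx 0 i : 'rV[R]_n) f (partial i f x).
Proof. by move=> df; apply: DeriveDef => //; exact: diff_derivable. Qed.

Lemma test_function_box (phi : 'rV[R]_n -> R) : test_function phi ->
  exists2 M : R, 0 < M &
    forall x, ~ box (const_mx (- M)) (const_mx M) x ->
      phi x = 0 /\ forall i, partial i phi x = 0.
Proof.
move=> [sphi cphi]; have [M M0 KM] := compact_sub_box cphi.
exists M => // x xM.
have nphi : \forall y \near x, 0 = phi y.
  have xK : (~` closure [set x | phi x != 0]) x by move=> /KM.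
  have oK : open (~` closure [set x | phi x != 0]).
    by rewrite openC; exact: closed_closure.
  have : nbhs x (~` closure [set x | phi x != 0]) by exact: open_nbhs_nbhs.
  apply: filterS => y yK; apply/esym/eqP/negPn/negP => phiy.
  by apply: yK; exact: subset_closure.
split; first by rewrite -(nbhs_singleton nphi).
move=> i; rewrite /partial -(near_eq_derive _ nphi).
exact: derive_cst.
Qed.

Lemma test_function_continuous (phi : 'rV[R]_n -> R) : test_function phi ->
  continuous phi /\ forall i, continuous (partial i phi).
Proof.
move=> [sphi _]; split=> [x|i x]; apply: differentiable_continuous.
  exact: (sphi [::]).
exact: (sphi [:: i]).
Qed.

Lemma continuous_bounded_box f M : continuous f ->
  (forall x, ~ box (const_mx (- M)) (const_mx M) x -> f x = 0) ->
  exists K : R, forall x, `|f x| <= K.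
Proof.
move=> cf f0.
have [K K0 fK] := continuous_bounded_on cf
  (@compact_cbox R n (const_mx (- M)) (const_mx M)).
exists K => x; have [xM|/f0 ->] := pselect (box (const_mx (- M)) (const_mx M) x).
  exact/fK/box_sub_cbox.
by rewrite normr0.
Qed.

Lemma integrable_continuous_box f M : 0 < M -> continuous f ->
  (forall x, ~ box (const_mx (- M)) (const_mx M) x -> f x = 0) ->
  (lebesgue_rV R n).-integrable setT (EFin \o f).
Proof.
move=> M0 cf f0; have [K fK] := continuous_bounded_box cf f0.
apply: (integrable_bounded_box (ltW M0) _ fK f0).
exact: continuous_measurable_rV.
Qed.

(** The product of f with a test function has compact support, and the integral
    of its partial derivative vanishes. *)
Lemma C1_weak_gradient f (g : 'rV[R]_n -> 'rV[R]_n) :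
  (forall x i, is_derive x (delta_mx 0 i : 'rV[R]_n) f (g x 0 i)) ->
  continuous f -> (forall i, continuous (fun x => g x 0 i)) ->
  is_weak_gradient f g.
Proof.
move=> fg cf cg; split=> [i|i phi tphi]; first exact: continuous_loc_integrable.
have [M M0 phi0] := test_function_box tphi.
have [cphi cdphi] := test_function_continuous tphi.
have c1 : continuous (fun x => f x * partial i phi x).
  by move=> x; apply: continuousM; [exact: cf|exact: cdphi].
have c2 : continuous (fun x => g x 0 i * phi x).
  by move=> x; apply: continuousM; [exact: cg|exact: cphi].
have i1 := integrable_continuous_box M0 c1
  (fun x xM => etrans (congr1 _ ((phi0 x xM).2 i)) (mulr0 _)).
have i2 := integrable_continuous_box M0 c2
  (fun x xM => etrans (congr1 _ (phi0 x xM).1) (mulr0 _)).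
apply/eqP; rewrite -addr_eq0 -RintegralD//; apply/eqP.
have c12 : continuous (fun x => f x * partial i phi x + g x 0 i * phi x).
  by move=> x; exact: (cvgD (c1 x) (c2 x)).
have z12 x : ~ box (const_mx (- M)) (const_mx M) x ->
    f x * partial i phi x + g x 0 i * phi x = 0.
  by move=> /phi0[-> ->]; rewrite !mulr0 addr0.
have [K hK] := continuous_bounded_box c12 z12.
have dh x : is_derive x (delta_mx 0 i : 'rV[R]_n) (fun x => f x * phi x)
    (f x * partial i phi x + g x 0 i * phi x).
  apply: (is_derive_eq (is_deriveM (fg x i) (is_derive_partial i (tphi.1 [::] x)))).
  by rewrite /= /GRing.scale/= [phi x * _]mulrC.
rewrite /Rintegral (integral_directional_derivative M0 dh c12 hK)//.
by move=> x xM; split; [rewrite (phi0 x xM).1 mulr0|exact: z12].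
Qed.

End continuous_rV.

Section weak_gradient_uniqueness.
Variables (R : realType) (n : nat).
Local Notation mu := (lebesgue_rV R n).
Implicit Types (f : 'rV[R]_n -> R) (g : 'rV[R]_n -> 'rV[R]_n).

Lemma loc_integrableB f1 f2 : loc_integrable f1 -> loc_integrable f2 ->
  loc_integrable (fun x => f1 x - f2 x).
Proof.
move=> [m1 i1] [m2 i2]; split; first exact: measurable_funB.
move=> K cK; have mK := measurable_compact_rV cK.
have I1 : mu.-integrable K (EFin \o f1).
  by apply/integrableP; split; [exact/measurable_EFinP/measurable_funTS|exact: i1].
have I2 : mu.-integrable K (EFin \o f2).
  by apply/integrableP; split; [exact/measurable_EFinP/measurable_funTS|exact: i2].
by have /integrableP[] := integrableB mK I1 I2.
Qed.

(** A test function is bounded and vanishes outside a compact box. *)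
Lemma loc_integrable_mul_test f phi : loc_integrable f -> test_function phi ->
  mu.-integrable setT (fun x => (f x * phi x)%:E).
Proof.
move=> lf tphi; have [M M0 phi0] := test_function_box tphi.
have [cphi _] := test_function_continuous tphi.
have [K hK] := continuous_bounded_box cphi (fun x xM => (phi0 x xM).1).
pose B : set 'rV[R]_n := cbox (const_mx (- M)) (const_mx M).
have iB : mu.-integrable setT ((EFin \o f) \_ B).
  by apply/(integrable_mkcond _ (@measurable_cbox R n _ _)); exact: loc_integrable_cbox.
apply: (le_integrable measurableT _ _ (integrableZl measurableT K iB)).
  apply/measurable_EFinP; apply: measurable_funM; first exact: lf.1.
  exact: continuous_measurable_rV.
move=> x _; rewrite patchE; case: ifPn => [_|].
  rewrite -EFinM /= lee_fin !normrM mulrC ler_wpM2r//.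
  exact: le_trans (hK x) (ler_norm _).
rewrite notin_setE => xB; rewrite (phi0 x _).1 ?mulr0 ?mule0//.
by move=> /box_sub_cbox.
Qed.

Lemma weak_gradient_unique f f' g g' :
  measurable_fun setT f -> measurable_fun setT f' ->
  {ae mu, forall x, f x = f' x} ->
  is_weak_gradient f g -> is_weak_gradient f' g' ->
  forall i, {ae mu, forall x, g x 0 i = g' x 0 i}.
Proof.
move=> mf mf' ff' [lg wg] [lg' wg'] i.
suff : {ae mu, forall x, g x 0 i - g' x 0 i = 0}.
  by apply: filterS => x /eqP; rewrite subr_eq0 => /eqP.
apply: fundamental_lemma_variations; first exact: loc_integrableB.
move=> phi tphi.
have I1 := loc_integrable_mul_test (lg i) tphi.
have I2 := loc_integrable_mul_test (lg' i) tphi.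
under eq_Rintegral do rewrite mulrBl.
rewrite RintegralB//.
apply/eqP; rewrite subr_eq0 -eqr_opp; apply/eqP.
rewrite -wg// -wg'//; congr fine; apply: ae_eq_integral => //.
- apply/measurable_EFinP; apply: measurable_funM => //.
  exact: continuous_measurable_rV ((test_function_continuous tphi).2 i).
- apply/measurable_EFinP; apply: measurable_funM => //.
  exact: continuous_measurable_rV ((test_function_continuous tphi).2 i).
- by move: ff'; apply: filterS => x /= -> _.
Qed.

End weak_gradient_uniqueness.

(** * Barenblatt profiles *)

Section positive_part_power.
Variable R : realType.

(** The power of the positive part through which the profiles depend on the
    paraboloid C - c |x - z|^2. *)
Definition pospow (a r : R) : R := Num.max 0 r `^ a.

Lemma pospow_gt0 a r : 0 < r -> pospow a r = r `^ a.
Proof. by move=> r0; rewrite /pospow max_r// ltW. Qed.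

Lemma pospow_le0 a r : a != 0 -> r <= 0 -> pospow a r = 0.
Proof. by move=> a0 r0; rewrite /pospow max_l// powR0. Qed.

Lemma pospow_continuous a : 0 < a -> continuous (pospow a).
Proof.
move=> a0 r; have an0 : a != 0 by rewrite gt_eqF.
have [r0|r0|r0] := ltgtP 0 r.
- have ca : {for r, continuous (fun s : R => s `^ a)}.
    apply/differentiable_continuous/derivable1_diffP.
    exact: (@ex_derive _ _ _ _ _ _ _ (is_derive1_powR a r0)).
  rewrite /continuous_at pospow_gt0//; apply: cvg_trans ca.
  apply: near_eq_cvg; near=> s; rewrite pospow_gt0//.
  by near: s; exact: lt_nbhsr.
- rewrite /continuous_at pospow_le0//; last exact: ltW.
  apply: cvg_near_cst; near=> s; rewrite pospow_le0//.
  by near: s; apply: filterS (lt_nbhsl r0) => s /ltW.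
- subst r; rewrite /continuous_at pospow_le0//.
  apply/cvgrPdist_lt => e e0.
  have /cvgrPdist_lt/(_ _ e0) [r /= r0 rP] := powR_cvg0 a0.
  near=> s; rewrite sub0r normrN.
  have [s0|s0] := ltP 0 s; last by rewrite pospow_le0// normr0.
  rewrite pospow_gt0// -normrN -sub0r; apply: rP => //=.
Unshelve. all: by end_near. Qed.

(** An exponent above 1 makes the derivative vanish continuously at the boundary
    of the positivity set. This is why the m-th power of a profile, with exponent
    m / (m - 1), has a classical gradient although the profile itself may not. *)
Lemma is_derive_pospow (a r : R) : 1 < a ->
  is_derive r 1 (pospow a) (a * pospow (a - 1) r).
Proof.
move=> a1; have an0 : a != 0 by rewrite gt_eqF// (lt_trans ltr01).
have a10 : a - 1 != 0 by rewrite subr_eq0 gt_eqF.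
have [r0|r0|r0] := ltgtP 0 r.
- apply: (@near_eq_is_derive R R R (fun s : R => s `^ a) (pospow a) r 1).
    near=> s; rewrite pospow_gt0//; near: s; exact: lt_nbhsr.
  by rewrite pospow_gt0//; exact: is_derive1_powR.
- apply: (@near_eq_is_derive R R R (cst 0) (pospow a) r 1).
    near=> s; rewrite pospow_le0//.
    by near: s; apply: filterS (lt_nbhsl r0) => s /ltW.
  by rewrite pospow_le0// ?(ltW r0)// mulr0; exact: (is_derive_cst (0 : R)).
- subst r; rewrite [pospow (a - 1) 0]pospow_le0// mulr0.
  apply/is_derive1_caratheodory; exists (pospow (a - 1)); split.
  + move=> z; rewrite [pospow a 0]pospow_le0// !subr0.
    have [z0|z0] := ltP 0 z; last by rewrite !pospow_le0// mul0r.
    rewrite !pospow_gt0// -[X in _ = _ * X](powRr1 (ltW z0)) -powRD subrK//.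
    by rewrite (negbTE an0).
  + by apply: pospow_continuous; rewrite subr_gt0.
  + by rewrite pospow_le0.
Unshelve. all: by end_near. Qed.

End positive_part_power.

Section squared_norm.
Variables (R : realType) (d : nat).

Lemma sqnorm20 : sqnorm2 (0 : 'rV[R]_d) = 0.
Proof. by rewrite /sqnorm2 big1// => i _; rewrite mxE expr0n. Qed.

Lemma sqnorm2Z (c : R) (x : 'rV[R]_d) : sqnorm2 (c *: x) = c ^+ 2 * sqnorm2 x.
Proof.
by rewrite /sqnorm2 mulr_sumr; apply: eq_bigr => i _; rewrite !mxE exprMn.
Qed.

Lemma sqnorm2_ge0 (x : 'rV[R]_d) : 0 <= sqnorm2 x.
Proof. by apply: sumr_ge0 => i _; exact: sqr_ge0. Qed.

Lemma sqnorm2_ge_coord (x : 'rV[R]_d) i : x 0 i ^+ 2 <= sqnorm2 x.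
Proof.
by rewrite /sqnorm2 (bigD1 i)//= lerDl sumr_ge0// => j _; exact: sqr_ge0.
Qed.

Lemma sqnorm2_continuous : continuous (@sqnorm2 R d).
Proof.
move=> x; rewrite /sqnorm2.
apply: (@cvg_big R 'I_d +%R 0 xpredT (@add_continuous R) _ (nbhs x)
  (index_enum 'I_d) (fun i (y : 'rV[R]_d) => y 0 i ^+ 2) (fun i => x 0 i ^+ 2)
  (nbhs_filter x)) => i _.
rewrite expr2; under eq_fun do rewrite expr2.
exact: (cvgM (@coord_continuous R 1 d 0 i x) (@coord_continuous R 1 d 0 i x)).
Qed.

(** Along the i-th axis the paraboloid is a polynomial of degree 2. *)
Lemma is_derive_sqnorm2 (c : R) (z x : 'rV[R]_d) i (C : R) :
  is_derive (0 : R) 1 (fun s : R => C - c * sqnorm2 (s *: delta_mx 0 i + x - z))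
    (- (c * (2 * (x - z) 0 i))).
Proof.
have E (s : R) : C - c * sqnorm2 (s *: delta_mx 0 i + x - z) =
    C - c * sqnorm2 (x - z) - c * (2 * (x - z) 0 i) * s - c * (s * s).
  rewrite -addrA /sqnorm2 [X in _ - c * X](bigD1 i)//= [in RHS](bigD1 i)//=.
  rewrite (eq_bigr (fun j => (x - z) 0 j ^+ 2)); last first.
    move=> j ji; congr (_ ^+ 2); rewrite !mxE (negbTE ji) andbF mulr0 add0r//.
  by rewrite !mxE !eqxx/= mulr1; ring.
under eq_fun do rewrite E.
apply: (is_derive_eq (is_deriveB (is_deriveB
   (is_derive_cst (C - c * sqnorm2 (x - z)) (0 : R) 1)
   (is_deriveM (is_derive_cst (c * (2 * (x - z) 0 i)) (0 : R) 1) (is_derive_id (0 : R) 1)))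
   (is_deriveM (is_derive_cst c (0 : R) 1)
     (is_deriveM (is_derive_id (0 : R) 1) (is_derive_id (0 : R) 1))))).
by rewrite /GRing.scale/=; ring.
Qed.

End squared_norm.

Section barenblatt_profile.
Variables (R : realType) (d : nat) (m : R).
Hypotheses (d_gt0 : (0 < d)%N) (m_gt1 : 1 < m).
Local Notation k := (barenblatt_k d m).
Local Notation q := (barenblatt_q d m).

(** The support of a profile expands like t^beta. *)
Definition barenblatt_beta : R := k / d%:R.
Local Notation beta := barenblatt_beta.

Let dR_gt0 : 0 < d%:R :> R. Proof. by rewrite ltr0n. Qed.
Let m0 : 0 < m. Proof. exact: lt_trans m_gt1. Qed.
Let m10 : 0 < m - 1. Proof. by rewrite subr_gt0. Qed.

Lemma barenblatt_k_gt0 : 0 < k.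
Proof. by rewrite invr_gt0 addr_gt0// divr_gt0. Qed.

Lemma barenblatt_beta_gt0 : 0 < beta.
Proof. by rewrite divr_gt0// barenblatt_k_gt0. Qed.

Lemma barenblatt_q_gt0 : 0 < q.
Proof. by rewrite mulr_gt0// ?barenblatt_beta_gt0// divr_gt0// mulr_gt0. Qed.

Lemma barenblatt_betaE : d%:R * beta = k.
Proof. by rewrite /beta mulrC divfK// gt_eqF. Qed.

Lemma barenblatt_k_beta : k * (m - 1) + 2 * beta = 1.
Proof.
rewrite /beta -[X in _ + X]mulrCA -mulrDr /barenblatt_k mulVf// gt_eqF//.
by rewrite addr_gt0// divr_gt0.
Qed.

Lemma barenblatt_q_beta : 2 * q * (m / (m - 1)) = beta.
Proof.
by rewrite /barenblatt_q -/beta; field; rewrite ?(gt_eqF m0) ?(gt_eqF m10).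
Qed.

Lemma barenblatt_ofE C z t (x : 'rV[R]_d) : barenblatt_of m C z t x =
  t `^ (- k) * pospow (m - 1)^-1 (C - q * t `^ (- (2 * beta)) * sqnorm2 (x - z)).
Proof. by rewrite /barenblatt_of /pospow /beta mulrA. Qed.

Lemma powR_beta_scale (t : R) : 0 < t -> t `^ (- (2 * beta)) * (t `^ beta) ^+ 2 = 1.
Proof.
move=> t0; rewrite -powR_mulrn ?powR_ge0// -powRrM -powRD; last first.
  by rewrite (gt_eqF t0) implybT.
by rewrite [beta * _]mulrC addNr powRr0.
Qed.

Lemma barenblatt_of_scale C z t (y : 'rV[R]_d) : 0 < t ->
  barenblatt_of m C z t (z + t `^ beta *: y) =
  t `^ (- k) * barenblatt_of m C 0 1 y.
Proof.
move=> t0; rewrite !barenblatt_ofE addrAC subrr add0r subr0 !powR1 mul1r.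
by rewrite sqnorm2Z -mulrA [X in _ - _ * X]mulrA powR_beta_scale// mul1r mulr1.
Qed.

Lemma paraboloid_continuous (C c : R) (z : 'rV[R]_d) :
  continuous (fun x : 'rV[R]_d => C - c * sqnorm2 (x - z)).
Proof.
move=> x.
have c1 : {for x, continuous (fun x : 'rV[R]_d => sqnorm2 (x - z))}.
  apply: (@continuous_comp _ _ _ (fun x : 'rV[R]_d => x - z) (@sqnorm2 R d)).
    exact: (cvgB cvg_id (cvg_cst z)).
  exact: sqnorm2_continuous.
exact: (cvgB (cvg_cst C) (cvgM (cvg_cst c) c1)).
Qed.

Lemma barenblatt_of_continuous C z t : continuous (@barenblatt_of R d m C z t).
Proof.
rewrite (funext (barenblatt_ofE C z t)) => x.
have c1 : {for x, continuous (pospow (m - 1)^-1 \o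
    (fun x => C - q * t `^ (- (2 * beta)) * sqnorm2 (x - z)))}.
  apply: continuous_comp; first exact: paraboloid_continuous.
  by apply: pospow_continuous; rewrite invr_gt0.
exact: (cvgM (cvg_cst _) c1).
Qed.

Lemma measurable_barenblatt_of C z t : measurable_fun setT (@barenblatt_of R d m C z t).
Proof. by apply: continuous_measurable_rV; exact: barenblatt_of_continuous. Qed.

Lemma barenblatt_of_ge0 C z t x : 0 <= @barenblatt_of R d m C z t x.
Proof. by rewrite mulr_ge0// powR_ge0. Qed.

(** The gradient of u^m equals - (beta / t) u (x - z): this linear relation
    between the gradient and the density is what makes the velocity linear. *)
Definition barenblatt_grad C z t (x : 'rV[R]_d) : 'rV[R]_d :=
  - (beta / t * barenblatt_of m C z t x) *: (x - z).

Lemma barenblatt_of_powm C z t (x : 'rV[R]_d) :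
  barenblatt_of m C z t x `^ m = t `^ (- k * m) *
    pospow (m / (m - 1)) (C - q * t `^ (- (2 * beta)) * sqnorm2 (x - z)).
Proof.
by rewrite barenblatt_ofE powRM ?powR_ge0// -powRrM /pospow -powRrM [m / _]mulrC.
Qed.

(** The chain rule; the powers of t match by k (m - 1) + 2 beta = 1, and the
    constants by the choice of q. *)
Lemma is_derive_barenblatt_powm C z t (x : 'rV[R]_d) i : 0 < t ->
  is_derive x (delta_mx 0 i : 'rV[R]_d) (fun x => barenblatt_of m C z t x `^ m)
    (barenblatt_grad C z t x 0 i).
Proof.
move=> t0; apply/is_derive_dirP.
under eq_fun do rewrite barenblatt_of_powm.
have a1 : 1 < m / (m - 1) by rewrite ltr_pdivlMr// mul1r gtrBl.
set a := m / (m - 1) in a1 *.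
set r := fun s : R => C - q * t `^ (- (2 * beta)) * sqnorm2 (s *: delta_mx 0 i + x - z).
have dr := is_derive_sqnorm2 (q * t `^ (- (2 * beta))) z x i C.
apply: (is_derive_eq (is_deriveM (is_derive_cst (t `^ (- k * m)) (0 : R) 1)
  (is_derive1_comp (is_derive_pospow (r 0) a1) dr))).
rewrite scaler0 addr0 /barenblatt_grad [RHS]mxE barenblatt_ofE /r scale0r add0r.
have -> : a - 1 = (m - 1)^-1 by rewrite /a; field; rewrite gt_eqF.
set p := pospow _ _; set y := (x - z) 0 i; rewrite /GRing.scale/=.
have -> : t `^ (- k) = t `^ (- k * m) * t `^ (- (2 * beta)) * t.
  rewrite -[X in _ = _ * X](powRr1 (ltW t0)) -!powRD ?(gt_eqF t0) ?implybT//.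
  by congr (_ `^ _); have := barenblatt_k_beta; lra.
by rewrite -barenblatt_q_beta -/a; field; rewrite gt_eqF.
Qed.

Lemma barenblatt_of_powm_continuous C z t :
  continuous (fun x : 'rV[R]_d => barenblatt_of m C z t x `^ m).
Proof.
rewrite (funext (barenblatt_of_powm C z t)) => x.
have c1 : {for x, continuous (pospow (m / (m - 1)) \o
    (fun x => C - q * t `^ (- (2 * beta)) * sqnorm2 (x - z)))}.
  apply: continuous_comp; first exact: paraboloid_continuous.
  by apply: pospow_continuous; rewrite divr_gt0.
exact: (cvgM (cvg_cst _) c1).
Qed.

Lemma barenblatt_weak_gradient C z t : 0 < t ->
  is_weak_gradient (fun x : 'rV[R]_d => barenblatt_of m C z t x `^ m)
    (barenblatt_grad C z t).
Proof.
move=> t0; apply: C1_weak_gradient.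
- by move=> x i; exact: is_derive_barenblatt_powm.
- exact: barenblatt_of_powm_continuous.
- move=> i x.
  have -> : (fun x => barenblatt_grad C z t x 0 i) = (fun x =>
      - (beta / t * barenblatt_of m C z t x) * (x 0 i - z 0 i)).
    by apply/funext => y; rewrite !mxE.
  have c1 := @barenblatt_of_continuous C z t x.
  exact: (cvgM (cvgN (cvgM (cvg_cst _) c1))
    (cvgB (@coord_continuous R 1 d 0 i x) (cvg_cst (z 0 i)))).
Qed.

End barenblatt_profile.

(** * The Barenblatt flow of laws *)

Section times.
Variable R : realType.
Implicit Types r s t : time R.

Lemma rtime_ge0 t : 0 <= rtime t.
Proof. by rewrite /rtime. Qed.

Lemma rtime_inj s t : rtime s = rtime t -> s = t.
Proof. by move=> h; exact: val_inj. Qed.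

Lemma to_timeK t : to_time (rtime t) = t.
Proof.
by apply: val_inj; rewrite /= ger0_norm// /rtime.
Qed.

Lemma rtime_to_time (s : R) : 0 <= s -> rtime (to_time s) = s.
Proof. by move=> s0; rewrite /rtime/= ger0_norm. Qed.

Lemma to_time_continuous : continuous (@to_time R).
Proof.
apply: (@continuous_comp_initial _ _ _ (fun t : {nonneg R} => t%:num)).
by move=> s; exact: norm_continuous.
Qed.

Lemma addt0 t : addt t (to_time 0) = t.
Proof. by apply: rtime_inj; rewrite /rtime/= normr0 addr0. Qed.

Lemma add0t r t : rtime r = 0 -> addt r t = t.
Proof. by move=> r0; apply: rtime_inj; rewrite -[RHS]add0r -r0. Qed.

Lemma addtA r s t : addt r (addt s t) = addt (addt r s) t.
Proof. by apply: rtime_inj; rewrite /rtime/= addrA. Qed.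

Lemma addtC s t : addt s t = addt t s.
Proof. by apply: rtime_inj; rewrite /rtime/= addrC. Qed.

Lemma addt_eq0 r s : rtime (addt r s) = 0 -> rtime r = 0 /\ rtime s = 0.
Proof.
move=> /eqP; rewrite [X in X == _]/(rtime r + rtime s) paddr_eq0 ?rtime_ge0//.
by move=> /andP[/eqP ? /eqP ?].
Qed.

End times.

Section density_laws.
Variables (R : realType) (d : nat).
Local Notation mu := (lebesgue_rV R d).

Lemma prob_density_integrable (u : 'rV[R]_d -> R) : prob_density u ->
  mu.-integrable setT (EFin \o u).
Proof.
move=> [mu_ u0 u1]; apply/integrableP; split; first exact/measurable_EFinP.
under eq_integral => x _ do rewrite /= ger0_norm//.
by rewrite -[X in (X < _)%E]/(density_law u setT) u1 ltry.
Qed.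

(** A density is recovered from its law up to a null set. *)
Lemma density_law_ae_eq (u v : 'rV[R]_d -> R) : prob_density u ->
  measurable_fun setT v -> same_law (density_law u) (density_law v) ->
  {ae mu, forall x, u x = v x}.
Proof.
move=> pu mv uv.
have : ae_eq mu setT (EFin \o u) (EFin \o v).
  apply: integral_ae_eq => //; first exact: prob_density_integrable.
    exact/measurable_EFinP.
  by move=> E _ mE; exact: uv.
by apply: filterS => x /(_ I) [].
Qed.

Lemma lebesgue_rV_open_gt0 (U : set 'rV[R]_d) x : open U -> U x ->
  (0 < mu U)%E.
Proof.
move=> oU Ux; have /nbhs_ballP[e /= e0 eU] : nbhs x U by exact: open_nbhs_nbhs.
have bU : box (\row_i (x 0 i - e)) (\row_i (x 0 i + e)) `<=` U.
  move=> y bxy; apply: eU; split=> // i j; rewrite ord1 ball_itv/= in_itv/=.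
  by have := bxy j; rewrite !mxE.
apply: (@lt_le_trans _ _ (mu (box (\row_i (x 0 i - e)) (\row_i (x 0 i + e))))).
  rewrite lebesgue_rV_box; last by move=> i; rewrite !mxE; lra.
  rewrite lte_fin; apply: prodr_gt0 => i _; rewrite !mxE; lra.
by apply: le_measure => //; rewrite inE; [exact: measurable_box|exact: measurable_open_mx].
Qed.

(** The set where two continuous functions differ is open, and open sets that are
    not empty have positive measure. *)
Lemma ae_eq_continuous (f g : 'rV[R]_d -> R) : continuous f -> continuous g ->
  {ae mu, forall x, f x = g x} -> f = g.
Proof.
move=> cf cg [N [mN N0 fgN]]; apply/funext => x; apply/eqP/negPn/negP => fgx.
pose h (x : 'rV[R]_d) : R := `|f x - g x|.
have ch : continuous h.
  by move=> y; exact: (cvg_norm (cvgB (cf y) (cg y))).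
pose U := h @^-1` [set r | 0 < r].
have oU : open U.
  by move/continuousP : ch; apply; exact: open_gt.
have Ux : U x by rewrite /U /= /h normr_gt0 subr_eq0.
have := lebesgue_rV_open_gt0 oU Ux; rewrite ltNge => /negP; apply.
rewrite -N0; apply: le_measure; rewrite ?inE//; first exact: measurable_open_mx.
move=> y; rewrite /U /= /h normr_gt0 subr_eq0 => /eqP fgy; exact: fgN.
Qed.

End density_laws.

Section barenblatt_laws.
Variables (R : realType) (d : nat) (m : R).
Hypotheses (d_gt0 : (0 < d)%N) (m_gt1 : 1 < m).
Local Notation k := (barenblatt_k d m).
Local Notation q := (barenblatt_q d m).
Local Notation beta := (barenblatt_beta d m).
Local Notation C := (barenblatt_C d m).
Hypothesis mass1 : density_law (@barenblatt R d m 0 1) setT = 1%E.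

Lemma barenblatt_scale z t (y : 'rV[R]_d) : 0 < t ->
  barenblatt m z t (z + t `^ beta *: y) = t `^ (- k) * barenblatt m 0 1 y.
Proof. exact: barenblatt_of_scale. Qed.

Lemma measurable_barenblatt (z : 'rV[R]_d) t : measurable_fun setT (barenblatt m z t).
Proof. exact: measurable_barenblatt_of. Qed.

Lemma barenblatt_ge0 (z : 'rV[R]_d) t x : 0 <= barenblatt m z t x.
Proof. exact: barenblatt_of_ge0. Qed.

Let m10 : 0 < m - 1. Proof. by rewrite subr_gt0. Qed.
Let mV0 : (m - 1)^-1 != 0. Proof. by rewrite invr_eq0 gt_eqF. Qed.

(** For C <= 0 the profile vanishes and cannot have mass 1. Thus the assumption
    that the law of eta has the profile as density provides the properties of the
    normalising constant. *)
Lemma barenblatt_C_gt0 : 0 < C.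
Proof.
rewrite ltNge; apply/negP => C0.
have := mass1; rewrite /density_law integral0_eq => [|x _].
  by move/eqP; rewrite eq_sym onee_eq0.
rewrite /barenblatt barenblatt_ofE pospow_le0 ?mulr0//.
apply: le_trans C0; have q0 := barenblatt_q_gt0 d_gt0 m_gt1.
by rewrite gerBl mulr_ge0 ?sqnorm2_ge0// mulr_ge0 ?powR_ge0// ltW.
Qed.

(** The factor t^(- k) of the profile cancels the Jacobian t^(d beta) of the
    dilation, as d beta = k. *)
Lemma density_law_barenblatt z t (A : set 'rV[R]_d) : 0 < t -> measurable A ->
  density_law (barenblatt m z t) A =
  density_law (barenblatt m 0 1) [set y | A (z + t `^ beta *: y)].
Proof.
move=> t0 mA; have tb : 0 < t `^ beta by rewrite powR_gt0.
rewrite /density_law -(@integral_rV_affine_set R d z (t `^ beta))//; last 2 first.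
- by apply/measurable_EFinP; exact: measurable_barenblatt.
- by move=> x; rewrite lee_fin barenblatt_ge0.
under eq_integral => x _ do rewrite barenblatt_scale// EFinM.
have mS := measurable_affine_preimage z (t `^ beta) mA.
rewrite ge0_integralZl//; last 3 first.
- by apply: measurable_funTS; apply/measurable_EFinP; exact: measurable_barenblatt.
- by move=> x _; rewrite lee_fin barenblatt_ge0.
- by rewrite lee_fin powR_ge0.
rewrite muleA -EFinM -powR_mulrn ?powR_ge0// -powRrM -powRD ?(gt_eqF t0) ?implybT//.
by rewrite mulrC barenblatt_betaE// subrr powRr0 mul1e.
Qed.

Lemma barenblatt_prob_density (z : 'rV[R]_d) t : 0 < t ->
  prob_density (barenblatt m z t).
Proof.
move=> t0; split; [exact: measurable_barenblatt|exact: barenblatt_ge0|].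
by rewrite density_law_barenblatt.
Qed.

Lemma barenblatt_Pstar (z : 'rV[R]_d) t : 0 < t -> Pstar m (barenblatt m z t).
Proof.
move=> t0; split; first exact: barenblatt_prob_density.
have wg := barenblatt_weak_gradient d_gt0 m_gt1 C z t0.
split; last by exists (barenblatt_grad m C z t).
apply: continuous_loc_integrable; exact: barenblatt_of_powm_continuous.
Qed.

(** The paraboloid decreases with the distance to the centre, and C > 0 makes the
    profile positive there, so that the maximum is strict. *)
Lemma barenblatt_le_center (z : 'rV[R]_d) t x : 0 < t ->
  barenblatt m z t x <= barenblatt m z t z ?= iff (x == z).
Proof.
move=> t0; have q0 := barenblatt_q_gt0 d_gt0 m_gt1.
have c0 : 0 < q * t `^ (- (2 * beta)) by rewrite mulr_gt0// powR_gt0.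
have tk0 : 0 < t `^ (- k) by rewrite powR_gt0.
have C0 := barenblatt_C_gt0.
rewrite /barenblatt !barenblatt_ofE subrr sqnorm20.
rewrite mulr0 subr0; apply/leifP; case: eqP => [->|/eqP xz].
  by rewrite subrr sqnorm20 mulr0 subr0.
rewrite ltr_pM2l// [ltRHS]pospow_gt0//.
have s0 : 0 < sqnorm2 (x - z).
  rewrite lt_neqAle sqnorm2_ge0 andbT eq_sym; apply: contra_neq xz => s0.
  apply/eqP; rewrite -subr_eq0; apply/eqP/rowP => i; rewrite [RHS]mxE.
  by apply/eqP; rewrite -sqrf_eq0 eq_le sqr_ge0 andbT -s0 sqnorm2_ge_coord.
have [r0|r0] := ltP 0 (C - q * t `^ (- (2 * beta)) * sqnorm2 (x - z)).
  rewrite pospow_gt0//; apply: gt0_ltr_powR; rewrite ?invr_gt0// ?nnegrE ?ltW//.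
  by rewrite gtrBl mulr_gt0.
by rewrite pospow_le0// powR_gt0.
Qed.

(** The centre is the only maximum, and the maximum t^(- k) C^(1 / (m - 1))
    determines t. *)
Lemma barenblatt_inj (z z' : 'rV[R]_d) t t' : 0 < t -> 0 < t' ->
  barenblatt m z t = barenblatt m z' t' -> t = t' /\ z = z'.
Proof.
move=> t0 t'0 BB.
have h1 := barenblatt_le_center z z' t0; have h2 := barenblatt_le_center z' z t'0.
have zz : z' = z.
  apply/eqP; rewrite -h1.2 eq_le h1.1/= BB.
  exact: h2.1.
rewrite zz in BB *; split; last exact: erefl.
move: BB => /(congr1 (fun f => f z)) {h1 h2}; rewrite /barenblatt !barenblatt_ofE subrr.
rewrite sqnorm20 !mulr0 subr0 => /mulIf tt'.
have k0 := barenblatt_k_gt0 d_gt0 m_gt1.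
have {}tt' : t `^ (- k) = t' `^ (- k).
  by apply: tt'; rewrite pospow_gt0 ?barenblatt_C_gt0// gt_eqF// powR_gt0 ?barenblatt_C_gt0.
have := congr1 (fun r => r `^ (- k^-1)) tt'; rewrite -!powRrM mulrNN mulfV ?gt_eqF//.
by rewrite !powRr1// ltW.
Qed.

Lemma barenblatt_flow0 (t : time R) (z : 'rV[R]_d) : rtime t = 0 ->
  barenblatt_flow m t z = \d_z.
Proof. by move=> t0; rewrite /barenblatt_flow t0 eqxx. Qed.

Lemma barenblatt_flow_gt0 (t : time R) (z : 'rV[R]_d) : 0 < rtime t ->
  barenblatt_flow m t z = density_law (barenblatt m z (rtime t)).
Proof. by move=> t0; rewrite /barenblatt_flow gt_eqF. Qed.

Lemma density_law_set1 (u : 'rV[R]_d -> R) (x : 'rV[R]_d) :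
  measurable_fun setT u -> density_law u [set x] = 0%E.
Proof.
move=> mu_; apply: null_set_integral; first exact: measurable_set1_rV.
  exact/measurable_EFinP/measurable_funTS.
by case: d d_gt0 x => // n _ x; exact: lebesgue_rV_set1.
Qed.

(** Points are null sets in positive dimension, so a law with a density differs
    from the Dirac masses at time 0; two laws at positive times have equal
    densities, first almost everywhere and then everywhere by continuity. *)
Lemma barenblatt_flow_inj (t t' : time R) (z z' : 'rV[R]_d) :
  same_law (barenblatt_flow m t z) (barenblatt_flow m t' z') ->
  t = t' /\ z = z'.
Proof.
have dirac_density (s : R) (x y : 'rV[R]_d) : 0 < s ->
    ~ same_law \d_x (density_law (barenblatt m y s)).
  move=> s0 /(_ _ (measurable_set1_rV x)).
  rewrite density_law_set1; last exact: measurable_barenblatt.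
  by rewrite diracE mem_set// => /eqP; rewrite onee_eq0.
have := rtime_ge0 t; rewrite le_eqVlt => /predU1P[/esym t0|t0];
have := rtime_ge0 t'; rewrite le_eqVlt => /predU1P[/esym t'0|t'0].
- rewrite !barenblatt_flow0// => /(_ _ (measurable_set1_rV z)).
  rewrite !diracE mem_set//=; case: (boolP (z' \in _)) => [|_ /eqP].
    by rewrite inE => <- _; split=> //; apply: rtime_inj; rewrite t0.
  by rewrite onee_eq0.
- by rewrite barenblatt_flow0// barenblatt_flow_gt0// => /dirac_density; case.
- rewrite barenblatt_flow_gt0// barenblatt_flow0// => h.
  by exfalso; apply: (dirac_density _ z' z t0) => A mA; rewrite h.
- rewrite !barenblatt_flow_gt0// => h.
  have : barenblatt m z (rtime t) = barenblatt m z' (rtime t').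
    apply: ae_eq_continuous; [exact: barenblatt_of_continuous..|].
    apply: density_law_ae_eq; [|exact: measurable_barenblatt|exact: h].
    exact: barenblatt_prob_density.
  by move=> /(barenblatt_inj t0 t'0)[/rtime_inj].
Qed.

End barenblatt_laws.

(** * Borel sets and measurable processes in the path space *)

Section path_borel.
Variables (R : realType) (d : nat).
Local Notation path := (path_space R d).

Lemma path_coord_continuous (w : path) i : continuous (fun s : R => w (to_time s) 0 i).
Proof.
move=> s.
apply: (@continuous_comp _ _ _ (fun s => w (to_time s)) (fun x : 'rV[R]_d => x 0 i)).
  apply: continuous_comp; first exact: to_time_continuous.
  exact: cts_fun.
exact: coord_continuous.
Qed.

(** Uniform closeness to w on [0, n) up to 1 / (n + 1); these sets form a basis of
    neighbourhoods of w. *)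
Definition tube (w : path) (n : nat) : set path :=
  [set v : path | forall t i, rtime t < n%:R -> `|v t 0 i - w t 0 i| < n.+1%:R^-1].

Lemma tube_nbhs (U : set path) (w : path) : open U -> U w ->
  exists n, tube w n `<=` U.
Proof.
pose f (v : path) : {family compact, time R -> 'rV[R]_d} := (fun t => v t).
move=> [V oV <-] Vw.
pose F : set_system path := filter_from setT (tube w).
have FF : Filter F.
  apply: filter_fromT_filter; first by exists 0%N.
  move=> i j; exists (maxn i j) => v hv; split => t k ti.
    apply: lt_le_trans (hv t k _) _.
      by apply: lt_le_trans ti _; rewrite ler_nat leq_maxl.
    by rewrite lef_pV2 ?posrE// ler_nat ltnS leq_maxl.
  apply: lt_le_trans (hv t k _) _.
    by apply: lt_le_trans ti _; rewrite ler_nat leq_maxr.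
  by rewrite lef_pV2 ?posrE// ler_nat ltnS leq_maxr.
have fF : f @ F --> f w.
  apply/fam_cvgP => K cK.
  move=> P /uniform_nbhs [E [entE EP]].
  move: entE; rewrite -entourage_ballE => -[e /= e0 eE].
  have [M KM] : exists M : nat, forall t, K t -> rtime t < M%:R.
    have : compact [set rtime t | t in K].
      apply: continuous_compact => //; apply: continuous_subspaceT.
      exact: rtime_continuous.
    move=> /compact_bounded [M0 [_ hM]].
    exists (Num.truncn (`|M0| + 1)).+1 => t Kt.
    apply: le_lt_trans (truncnS_gt _).
    apply: le_trans (ler_norm _) _; apply: (hM (`|M0| + 1)).
      by rewrite (le_lt_trans (ler_norm _))// ltrDl.
    by exists t.
  have [n _ /(_ n (leqnn n)) /=] := near_infty_natSinv_lt (PosNum e0).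
  move=> ne; exists (maxn M n) => // v hv; apply: EP => t Kt; apply: eE.
  split=> // i j; rewrite ord1 /ball/= distrC.
  apply: lt_trans (hv t j _) _.
    by apply: lt_le_trans (KM t Kt) _; rewrite ler_nat leq_maxl.
  apply: le_lt_trans ne.
  by rewrite lef_pV2 ?posrE// ler_nat ltnS leq_maxr.
have /fF [n _ nV] : nbhs (f w) V by exact: open_nbhs_nbhs.
by exists n => v /nV.
Qed.

Lemma path_uniformly_continuous (w : path) (n : nat) (e : R) : 0 < e ->
  exists l : nat, forall (s t : R) i, 0 <= s -> s <= n%:R ->
    `|s - t| < l.+1%:R^-1 -> `|w (to_time s) 0 i - w (to_time t) 0 i| < e.
Proof.
move=> e0.
have cov := (compact_near_coveringP `[0 : R, n%:R]).1 (@segment_compact R 0 n%:R).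
have := cov nat \oo (fun l s => forall t i, `|s - t| < l.+1%:R^-1 ->
    `|w (to_time s) 0 i - w (to_time t) 0 i| < e) _ _.
case=> [s sn|l _ /(_ l (leqnn l)) hl]; last first.
  exists l => s t i s0 sn; apply: hl.
  by rewrite /= in_itv/= s0.
have e20 : 0 < e / 2 by rewrite divr_gt0.
have : \forall s' \near s, forall i, `|w (to_time s) 0 i - w (to_time s') 0 i| < e / 2.
  apply: (@filter_forall _ _ _ _ (nbhs_filter s)) => i.
  by have /cvgrPdist_lt/(_ _ e20) := @path_coord_continuous w i s.
move=> /nbhs_ballP [r /= r0 hr].
have r20 : 0 < r / 2 by rewrite divr_gt0.
near=> s' l => t i s't.
have ss' : `|s - s'| < r / 2 by near: s'; exact: nbhsx_ballx.
have lr : l.+1%:R^-1 < r / 2 by near: l; exact: (near_infty_natSinv_lt (PosNum r20)).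
have {}s't : `|s' - t| < r / 2 by exact: lt_trans s't lr.
rewrite /=.
have h1 : `|w (to_time s) 0 i - w (to_time s') 0 i| < e / 2.
  by apply: hr; rewrite /ball/=; lra.
have h2 : `|w (to_time s) 0 i - w (to_time t) 0 i| < e / 2.
  apply: hr; rewrite /ball/=.
  have := ler_normD (s - s') (s' - t); rewrite addrA subrK => /le_lt_trans; apply.
  by lra.
rewrite (_ : _ - _ = (w (to_time s') 0 i - w (to_time s) 0 i) +
   (w (to_time s) 0 i - w (to_time t) 0 i)); last by rewrite addrA subrK.
apply: le_lt_trans (ler_normD _ _) _.
by rewrite distrC; lra.
Unshelve. all: by end_near. Qed.


(** A countable substitute for the tubes: closeness at rational times to a step
    function with rational values, of which r lists the values on the intervals
    [j / (l + 1), (j + 1) / (l + 1)). Only evaluations at countably many times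
    enter, so these sets are measurable in terms of the coordinates. *)
Definition rtube (n l : nat) (r : seq 'rV[rat]_d) : set path :=
  \bigcap_(q in [set q : rat | 0 <= q < n%:R]) \bigcap_(i in setT)
    [set v : path | `|v (to_time (ratr q)) 0 i -
      ratr (nth 0 r (Num.truncn (q * l.+1%:R)) 0 i)| <= (3 * n.+1%:R)^-1].

(** Two paths that are 1 / (3 (n + 1)) close to the same step function at rational
    times are 2 / (3 (n + 1)) close to each other at all times, by continuity. *)
Lemma rtube_tube n l r (v w : path) : rtube n l r v -> rtube n l r w -> tube w n v.
Proof.
move=> hv hw t i tn.
pose h (s : R) : R := `|v (to_time s) 0 i - w (to_time s) 0 i|.
have ch : continuous h.
  move=> s; exact: (cvg_norm (cvgB (@path_coord_continuous v i s)
    (@path_coord_continuous w i s))).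
pose e : R := (3 * n.+1%:R)^-1.
have he : h (rtime t) <= 2 * e.
  rewrite leNgt; apply/negP => he.
  (* By continuity the two paths are also too far apart at a rational time. *)
  have o1 : open (h @^-1` [set r | 2 * e < r]).
    by move/continuousP : ch; apply; exact: open_gt.
  have o2 : open ([set s : R | s < n%:R] `&` h @^-1` [set r | 2 * e < r]).
    by apply: openI => //; exact: open_lt.
  have /nbhs_ballP[a /= a0 ha] : nbhs (rtime t)
      ([set s : R | s < n%:R] `&` h @^-1` [set r | 2 * e < r]).
    by apply: open_nbhs_nbhs; split.
  have ta : rtime t < rtime t + a by rewrite ltrDl.
  have [q] := rat_in_itvoo ta; rewrite in_itv/= => /andP[tq qa].
  have [qn eq] : ([set s : R | s < n%:R] `&` h @^-1` [set r | 2 * e < r]) (ratr q).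
    by apply: ha; rewrite /ball/= ltr_norml; apply/andP; split; lra.
  have q0n : 0 <= q < n%:R.
    rewrite -(ler0q R) -(ltr_rat R) ratr_nat qn andbT.
    by rewrite (le_trans _ (ltW tq))// rtime_ge0.
  pose x : R := ratr (nth 0 r (Num.truncn (q * l.+1%:R)) 0 i).
  have vx : `|v (to_time (ratr q)) 0 i - x| <= e := hv q q0n i I.
  have wx : `|w (to_time (ratr q)) 0 i - x| <= e := hw q q0n i I.
  move: eq; rewrite /= ltNge => /negP; apply; rewrite /h.
  rewrite (_ : _ - _ = (v (to_time (ratr q)) 0 i - x) + (x - w (to_time (ratr q)) 0 i)).
    by apply: le_trans (ler_normD _ _) _; rewrite [X in _ + X]distrC; lra.
  by rewrite addrA subrK.
move: he; rewrite /h to_timeK => /le_lt_trans; apply.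
rewrite /e invfM mulrA gtr_pMl ?invr_gt0//.
by rewrite ltr_pdivrMr// mul1r ltr_nat.
Qed.

Lemma rtube_cover (w : path) n : exists l r, rtube n l r w.
Proof.
have e0 : 0 < (3 * n.+1%:R)^-1 / 2 :> R by rewrite divr_gt0// invr_gt0 mulr_gt0.
have [l hl] := @path_uniformly_continuous w n _ e0.
have gex (j : nat) (i : 'I_d) : exists x : rat,
    `|w (to_time (j%:R / l.+1%:R)) 0 i - ratr x| < (3 * n.+1%:R)^-1 / 2.
  set a := w _ 0 i; set e := _ / 2 in e0 *.
  have xa : a - e < a + e by lra.
  have [x] := rat_in_itvoo xa.
  by rewrite in_itv/= => /andP[h1 h2]; exists x; rewrite ltr_norml; lra.
exists l, [seq \row_i projT1 (cid (gex j i)) | j <- iota 0 (n * l.+1)].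
move=> q /= /andP[q0 qn] i _.
set j := Num.truncn _.
have qj : j%:R <= q * l.+1%:R < j.+1%:R by apply: truncn_itv; rewrite mulr_ge0.
have jn : (j < n * l.+1)%N.
  rewrite -(ltr_nat rat); apply: le_lt_trans (andP qj).1 _.
  by rewrite natrM ltr_pM2r.
rewrite (nth_map 0%N) ?size_iota// nth_iota// add0n mxE.
have := projT2 (cid (gex j i)); set x := projT1 _ => h1 /=.
have qR : (j%:R : R) / l.+1%:R <= ratr q < (j%:R : R) / l.+1%:R + l.+1%:R^-1.
  rewrite ler_pdivrMr// -[X in _ < _ + X]mul1r -mulrDl ltr_pdivlMr//.
  rewrite -(ratr_nat R j) -(ratr_nat R l.+1) -rmorphM/= ler_rat.
  by rewrite -[X in _ + X](ratr_nat R 1) -rmorphD/= ltr_rat natr1.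
have h2 := hl (ratr q) (j%:R / l.+1%:R) i _ _ _.
have {}h2 : `|w (to_time (ratr q)) 0 i - w (to_time (j%:R / l.+1%:R)) 0 i| <
    (3 * n.+1%:R)^-1 / 2.
  apply: h2; rewrite ?ler0q//.
    by rewrite -(ratr_nat R n) ler_rat ltW.
  by case/andP: qR => ? ?; rewrite ger0_norm ?subr_ge0// ltrBlDl.
rewrite (_ : _ - _ = (w (to_time (ratr q)) 0 i - w (to_time (j%:R / l.+1%:R)) 0 i) +
  (w (to_time (j%:R / l.+1%:R)) 0 i - ratr x)); last by rewrite addrA subrK.
apply: le_trans (ler_normD _ _) _; apply: ltW.
by rewrite [ltRHS]splitr ltrD.
Qed.

(** The Borel sigma-algebra is generated by the coordinates, since every open set
    is a countable union of sets that the coordinates define. *)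
Lemma open_path_rtube (U : set path) : open U ->
  U = \bigcup_(c in [set c : nat * nat * seq 'rV[rat]_d | rtube c.1.1 c.1.2 c.2 `<=` U])
    rtube c.1.1 c.1.2 c.2.
Proof.
move=> oU; apply/seteqP; split=> [w Uw|w [c /= cU]]; last exact: cU.
have [n nU] := tube_nbhs oU Uw.
have [l [r wr]] := rtube_cover w n.
exists (n, l, r) => //= v vr; apply: nU; exact: rtube_tube vr wr.
Qed.

Lemma measurable_fun_path dO (Omega : measurableType dO) (X : Omega -> path) :
  (forall t, measurable_fun setT (fun w => X w t)) -> measurable_fun setT X.
Proof.
move=> mX; apply: (@measurability _ _ _ _ setT X open erefl).
move=> _ [U oU <-]; rewrite setTI (open_path_rtube oU) preimage_bigcup.
rewrite bigcup_mkcond; apply: countable_bigcupT_measurable => // -[[n l] r].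
case: ifPn => // _; rewrite /rtube/= preimage_bigcap bigcap_mkcond.
rewrite -[X in measurable X]setCK setC_bigcap; apply: measurableC.
apply: countable_bigcupT_measurable => // q; apply: measurableC; case: ifPn => // _.
rewrite preimage_bigcap; apply: fin_bigcap_measurable => // i _.
rewrite -[X in measurable X]setTI.
have mi : measurable_fun setT (fun w => X w (to_time (ratr q)) 0 i).
  exact: (measurableT_comp (@measurable_coord R 1 d 0 i) (mX _)).
pose a : R := ratr (nth 0 r (Num.truncn (q * l.+1%:R)) 0 i).
have mb : measurable_fun setT (fun w => `|X w (to_time (ratr q)) 0 i - a|).
  by apply: measurableT_comp => //; exact: measurable_funB.
rewrite (_ : _ `&` _ = setT `&` (fun w => `|X w (to_time (ratr q)) 0 i - a|) @^-1`
  `]-oo, (3 * n.+1%:R)^-1]).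
  exact: mb.
by apply/seteqP; split => w /=; rewrite in_itv.
Qed.

End path_borel.

Section joint_measurability.
Variables (R : realType) (d : nat).
Variables (dO : measure_display) (Omega : measurableType dO).
Variable X : Omega -> path_space R d.
Hypothesis mX : forall t, measurable_fun setT (fun w => X w t).

Let grid (n : nat) (s : R) : nat := Num.truncn (`|s| * n.+1%:R).

Let mgrid n j : measurable [set s : R | grid n s = j].
Proof.
rewrite (_ : mkset _ = (fun s : R => `|s|) @^-1` `[j%:R / n.+1%:R, j.+1%:R / n.+1%:R[).
  rewrite -[X in measurable X]setTI.
  by apply: (_ : measurable_fun setT (fun s : R => `|s|)) => //; exact: measurable_itv.
apply/seteqP; split => s /=; rewrite in_itv/= ler_pdivrMr// ltr_pdivlMr//.
  by move=> <-; apply: truncn_itv; rewrite mulr_ge0.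
by move=> /truncn_def.
Qed.

(** The path is the limit of its values at the grid points j / (n + 1), and such
    a discretisation is measurable in both variables. *)
Lemma measurable_path_joint i :
  measurable_fun setT (fun ws : Omega * measurableTypeR R => X ws.1 (to_time ws.2) 0 i).
Proof.
apply: (@measurable_fun_cvg _ _ _ _
  (fun n (ws : Omega * measurableTypeR R) =>
    X ws.1 (to_time ((grid n ws.2)%:R / n.+1%:R)) 0 i)).
  move=> n _ A mA; rewrite setTI.
  rewrite (_ : _ @^-1` _ = \bigcup_j
    (((fun w => X w (to_time (j%:R / n.+1%:R)) 0 i) @^-1` A) `*` [set s | grid n s = j])).
    apply: bigcupT_measurable => j; apply: measurableX; last exact: mgrid.
    rewrite -[X in measurable X]setTI.
    exact: (measurableT_comp (@measurable_coord R 1 d 0 i) (mX _)).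
  apply/seteqP; split => [[w s] /= h|[w s] [j _] /= [h gj]].
    by exists (grid n s).
  by rewrite gj.
move=> [w s] _ /=.
have -> : to_time s = to_time `|s|.
  by apply: val_inj => /=; rewrite normr_id.
suff h : (grid n s)%:R / n.+1%:R @[n --> \oo] --> (`|s| : R).
  exact: (cvg_comp _ _ h (@path_coord_continuous R d (X w) i `|s|)).
apply/cvgrPdist_lt => e e0; near=> n.
have /andP[h1 h2] : (grid n s)%:R <= `|s| * n.+1%:R < (grid n s).+1%:R.
  by apply: truncn_itv; rewrite mulr_ge0.
have : n.+1%:R^-1 < e by near: n; exact: (near_infty_natSinv_lt (PosNum e0)).
apply: le_lt_trans.
rewrite ger0_norm ?subr_ge0 ?ler_pdivrMr//.
by rewrite lerBlDl -[X in _ + X]mul1r -mulrDl natr1 ler_pdivlMr// ltW.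
Unshelve. all: by end_near. Qed.

End joint_measurability.

(** * The expanding process is a weak solution *)

Section power_rate_integral.
Variables (R : realType) (b : R).
Hypothesis b0 : 0 < b.

Definition power_rate (s : R) : R := if 0 < s then b * s `^ (b - 1) else 0.

Lemma power_rate_ge0 s : 0 <= power_rate s.
Proof.
by rewrite /power_rate; case: ifP => // _; rewrite mulr_ge0 ?powR_ge0// ltW.
Qed.

Lemma measurable_power_rate : measurable_fun setT power_rate.
Proof.
apply: measurable_fun_if => //.
- by apply: measurable_fun_ltr => //; exact: measurable_cst.
- by apply: measurable_funTS; apply: measurable_funM => //; exact: measurable_powR.
Qed.

Lemma integral_power_rate_away (e T : R) : 0 < e -> e < T ->
  (\int[lebesgue_measure]_(s in `[e, T]) (power_rate s)%:E = (T `^ b - e `^ b)%:E)%E.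
Proof.
move=> e0 eT.
have dF (s : R) : 0 < s -> is_derive s 1 (fun s : R => s `^ b) (b * s `^ (b - 1)).
  exact: is_derive1_powR.
have cp (a s : R) : 0 < s -> {for s, continuous (fun s : R => s `^ a)}.
  move=> s0; apply/differentiable_continuous/derivable1_diffP.
  exact: (@ex_derive _ _ _ _ _ _ _ (is_derive1_powR a s0)).
rewrite (@continuous_FTC2 _ power_rate (fun s => s `^ b))//.
- have cr : {within `[e, T], continuous (fun s : R => b * s `^ (b - 1))}.
    apply: continuous_in_subspaceT => s; rewrite inE/= in_itv/= => /andP[es _].
    apply: cvgMr; apply: cp; exact: lt_le_trans es.
  apply: (@subspace_eq_continuous _ _ _ _ _ _ cr) => s.
  rewrite inE/= in_itv/= => /andP[es _].
  by rewrite /= /from_subspace/= /power_rate (lt_le_trans e0 es).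
- split=> [s|  |].
  + rewrite in_itv/= => /andP[es _].
    exact: (@ex_derive _ _ _ _ _ _ _ (dF s (lt_trans e0 es))).
  + by apply: cvg_at_right_filter; exact: cp.
  + by apply: cvg_at_left_filter; apply: cp; exact: lt_trans eT.
- move=> s; rewrite in_itv/= => /andP[es _].
  rewrite derive1E (@derive_val _ _ _ _ _ _ _ (dF s (lt_trans e0 es))).
  by rewrite /power_rate (lt_trans e0 es).
Qed.

(** For b < 1 the rate is unbounded near 0: the fundamental theorem of calculus
    applies away from 0, and monotone convergence reaches 0. *)
Lemma integral_power_rate (T : R) : 0 <= T ->
  (\int[lebesgue_measure]_(s in `[0%R, T]) (power_rate s)%:E = (T `^ b)%:E)%E.
Proof.
rewrite le_eqVlt => /predU1P[<-|T0].
  by rewrite set_itv1 integral_set1 powR0// gt_eqF.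
have mr := measurable_power_rate.
pose F (n : nat) : set R := `[T / n.+2%:R, T]%classic.
have FE : \bigcup_n F n = `]0, T]%classic.
  apply/seteqP; split=> [s [n _]|s]; rewrite /F/= !in_itv/=.
    by move=> /andP[ns ->]; rewrite andbT; apply: lt_le_trans ns; rewrite divr_gt0.
  move=> /andP[s0 sT]; exists (Num.truncn (T / s)) => //=.
  rewrite in_itv/= sT andbT ler_pdivrMr// -ler_pdivrMl// mulrC.
  apply: le_trans (ltW (truncnS_gt _)) _.
  by rewrite ler_nat.
rewrite -integral_itv_obnd_cbnd; last exact/measurable_EFinP/measurable_funTS.
rewrite -FE.
have cv : (\int[lebesgue_measure]_(s in F n) (power_rate s)%:E @[n --> \oo] -->
    \int[lebesgue_measure]_(s in \bigcup_n F n) (power_rate s)%:E)%E.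
  apply: ge0_nondecreasing_set_cvg_integral => //.
  - move=> i j ij; apply/subsetPset => s; rewrite /F/= !in_itv/= => /andP[his ->].
    rewrite andbT; apply: le_trans his; rewrite ler_pM2l// lef_pV2 ?posrE//.
    by rewrite ler_nat !ltnS.
  - by move=> i; exact: measurable_itv.
  - by move=> i; exact/measurable_EFinP/measurable_funTS.
  - by move=> i s _; rewrite lee_fin power_rate_ge0.
have cw : (\int[lebesgue_measure]_(s in F n) (power_rate s)%:E @[n --> \oo] -->
    (T `^ b)%:E)%E.
  have -> : (fun n => \int[lebesgue_measure]_(s in F n) (power_rate s)%:E)%E =
      (fun n => (T `^ b - pospow b (T / n.+2%:R))%:E).
    apply/funext => n; rewrite integral_power_rate_away ?divr_gt0//.
      by rewrite pospow_gt0// divr_gt0.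
    by rewrite ltr_pdivrMr// ltr_pMr// ltr1n.
  apply: cvg_EFin; first exact: nearW.
  rewrite -[X in _ --> X]subr0 -[X in _ - X](@pospow_le0 _ b 0) ?gt_eqF//.
  apply: cvgB; first exact: cvg_cst.
  have h : T / n.+2%:R @[n --> \oo] --> (0 : R).
    rewrite -(mulr0 T); apply: cvgMr.
    have h := @cvg_harmonic R; rewrite -(@cvg_shiftS R (@harmonic R)) in h.
    exact: h.
  exact: (cvg_comp _ _ h (@pospow_continuous R b b0 0)).
exact: cvg_unique cv cw.
Qed.

End power_rate_integral.

Section almost_sure_from_density.
Variables (R : realType) (d : nat).
Variables (dO : measure_display) (Omega : measurableType dO) (P : probability Omega R).
Variables (Y : Omega -> 'rV[R]_d) (u : 'rV[R]_d -> R).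
Hypothesis mY : measurable_fun setT Y.
Hypothesis mu_ : measurable_fun setT u.
Hypothesis Yu : same_law (pushforward P Y) (density_law u).

Lemma ae_of_density (Q : set 'rV[R]_d) :
  {ae lebesgue_rV R d, forall x, Q x} -> {ae P, forall w, Q (Y w)}.
Proof.
move=> [N [mN N0 hN]]; exists (Y @^-1` N); split.
- by rewrite -[X in measurable X]setTI; exact: mY.
- rewrite -[LHS]/(pushforward P Y N) Yu//; apply: null_set_integral => //.
  exact/measurable_EFinP/measurable_funTS.
- by move=> w /= nQ; apply: hN.
Qed.

Lemma ae_density_neq0 : {ae P, forall w, u (Y w) != 0}.
Proof.
have mZ : measurable [set y | u y = 0].
  rewrite -[X in measurable X]setTI; rewrite (_ : mkset _ = u @^-1` [set 0]) //.
  by apply: mu_ => //; exact: measurable_set1.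
exists (Y @^-1` [set y | u y = 0]); split.
- by rewrite -[X in measurable X]setTI; exact: mY.
- rewrite -[LHS]/(pushforward P Y [set y | u y = 0]) Yu//.
  by apply: integral0_eq => y /= ->.
- by move=> w /=; move/negP/negPn/eqP.
Qed.

End almost_sure_from_density.

Section barenblatt_process.
Variables (R : realType) (d : nat) (m : R).
Hypotheses (d_gt0 : (0 < d)%N) (m_gt1 : 1 < m).
Variables (dO : measure_display) (Omega : measurableType dO) (P : probability Omega R).
Variable eta : {RV P >-> 'rV[R]_d}.
Hypothesis eta_law : same_law (distribution P eta) (density_law (barenblatt m 0 1)).
Local Notation beta := (barenblatt_beta d m).
Local Notation C := (barenblatt_C d m).
Local Notation q := (barenblatt_q d m).
Local Notation Xp z := (fun w : Omega => barenblatt_path m_gt1 z (eta w)).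

Lemma barenblatt_mass1 : density_law (@barenblatt R d m 0 1) setT = 1%E.
Proof. by rewrite -eta_law//; exact: probability_setT. Qed.
Let mass1 := barenblatt_mass1.

Let beta0 : 0 < beta. Proof. exact: barenblatt_beta_gt0. Qed.

Lemma barenblatt_pathE (z y : 'rV[R]_d) (t : time R) :
  barenblatt_path m_gt1 z y t = z + rtime t `^ beta *: y.
Proof. by []. Qed.

Lemma barenblatt_path0 (z y : 'rV[R]_d) (t : time R) : rtime t = 0 ->
  barenblatt_path m_gt1 z y t = z.
Proof.
by move=> t0; rewrite barenblatt_pathE t0 powR0 ?scale0r ?addr0// gt_eqF.
Qed.

Lemma measurable_barenblatt_path z :
  measurable_fun setT (@barenblatt_path R d m m_gt1 z).
Proof.
by apply: measurable_fun_path => t; exact: (measurable_affine_rV z (rtime t `^ beta)).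
Qed.

(** Time 0 fits in: the dilation by 0 sends every density to the Dirac mass at
    z. *)
Lemma barenblatt_flow_affine (t : time R) (z : 'rV[R]_d) (A : set 'rV[R]_d) :
  measurable A -> barenblatt_flow m t z A =
    density_law (barenblatt m 0 1) [set y | A (z + rtime t `^ beta *: y)].
Proof.
move=> mA; have := rtime_ge0 t; rewrite le_eqVlt => /predU1P[/esym t0|t0].
  rewrite barenblatt_flow0// t0 powR0 ?gt_eqF//.
  rewrite [X in density_law _ X](_ : _ = [set _ | A z]); last first.
    by apply/seteqP; split => y /=; rewrite scale0r addr0.
  rewrite diracE; have [Az|nAz] := pselect (A z).
    rewrite mem_set//= -mass1; congr density_law.
    by apply/seteqP; split.
  rewrite memNset//= [X in density_law _ X](_ : _ = set0).
    by rewrite /density_law integral_set0.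
  by apply/seteqP; split.
rewrite (barenblatt_flow_gt0 m z t0).
exact: density_law_barenblatt.
Qed.

Lemma barenblatt_process_marginals z : has_barenblatt_marginals m z P (Xp z).
Proof.
move=> t A mA; rewrite barenblatt_flow_affine//.
by rewrite -eta_law//; exact: measurable_affine_preimage.
Qed.

Lemma eta_support : {ae P, forall w, barenblatt m 0 1 (eta w) != 0}.
Proof.
apply: (ae_density_neq0 _ _ eta_law); first exact: measurable_funP.
exact: measurable_barenblatt.
Qed.

(** The coordinate cut off outside the positivity set: a bounded function that
    agrees with the coordinate almost surely along eta. *)
Definition support_coord (i : 'I_d) (y : 'rV[R]_d) : R :=
  if barenblatt m 0 1 y == 0 then 0 else y 0 i.

Lemma measurable_support_coord i : measurable_fun setT (support_coord i).
Proof.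
apply: measurable_fun_if => //.
- apply: measurable_fun_eqr; first exact: measurable_barenblatt.
  exact: measurable_cst.
- by apply: measurable_funTS; exact: measurable_coord.
Qed.

(** On the positivity set q |y|^2 < C. *)
Lemma support_coord_bounded i : exists2 K, 0 <= K & forall y, `|support_coord i y| <= K.
Proof.
have q0 := barenblatt_q_gt0 d_gt0 m_gt1.
have C0 := barenblatt_C_gt0 d_gt0 m_gt1 mass1.
have Cq : 0 < C / q by rewrite divr_gt0.
exists (C / q + 1) => [|y]; first by rewrite addr_ge0// ltW.
rewrite /support_coord; case: eqP => [_|/eqP]; first by rewrite normr0 addr_ge0// ltW.
rewrite /barenblatt barenblatt_ofE powR1 mul1r subr0 mulr1 => By.
have qy : q * sqnorm2 y < C.
  rewrite ltNge; apply/negP => Cy; move: By; rewrite pospow_le0 ?eqxx//.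
    by rewrite invr_eq0 subr_eq0 gt_eqF.
  by rewrite subr_le0.
have yi : y 0 i ^+ 2 < C / q.
  by apply: le_lt_trans (sqnorm2_ge_coord y i) _; rewrite ltr_pdivlMr// mulrC.
rewrite -(@ler_pXn2r _ 2)// ?nnegrE ?addr_ge0 ?(ltW Cq)// real_normK ?num_real//.
apply: le_trans (ltW yi) _; rewrite expr2.
nra.
Qed.

(** With the value 0 at times s <= 0 the drift vanishes there, and
    [process_drift] holds for all real s. *)
Definition process_density (z : 'rV[R]_d) (s : R) : 'rV[R]_d -> R :=
  if 0 < s then barenblatt m z s else cst 0.

Definition process_grad (z : 'rV[R]_d) (s : R) : 'rV[R]_d -> 'rV[R]_d :=
  barenblatt_grad m C z s.

Lemma barenblatt_drift (z x : 'rV[R]_d) (s : R) : 0 < s -> barenblatt m z s x != 0 ->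
  pme_drift (barenblatt m z s) (barenblatt_grad m C z s) x = (beta / s) *: (x - z).
Proof.
move=> s0 B0; rewrite /pme_drift (negbTE B0) /barenblatt_grad -/(barenblatt m z s x).
rewrite scaleNr scalerN opprK scalerA; congr (_ *: _).
by field; rewrite B0 gt_eqF.
Qed.

(** A point of the positivity set stays in the positivity set along its
    trajectory, and the drift factors into a random variable and a deterministic
    rate. *)
Lemma process_drift z w s i :
  pme_drift (process_density z s) (process_grad z s) (Xp z w (to_time s)) 0 i =
  support_coord i (eta w) * power_rate beta s.
Proof.
rewrite /process_density /power_rate /support_coord; case: ifPn => s0; last first.
  by rewrite /pme_drift /= eqxx mxE mulr0.
rewrite barenblatt_pathE rtime_to_time ?(ltW s0)//.
have tk : s `^ (- barenblatt_k d m) != 0 by rewrite gt_eqF// powR_gt0.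
case: ifPn => [/eqP B0|B0].
  by rewrite /pme_drift barenblatt_scale// B0 mulr0 eqxx mxE mul0r.
rewrite (barenblatt_drift s0); last by rewrite barenblatt_scale// mulf_neq0.
rewrite addrAC subrr add0r scalerA mxE mulrC; congr (_ * _).
by rewrite powRD ?(gt_eqF s0) ?implybT// powR_inv1 ?ltW//; field; rewrite gt_eqF.
Qed.

Lemma natural_filtration_filtration (Y : Omega -> path_space R d) :
  (forall t, measurable_fun setT (fun w => Y w t)) ->
  is_filtration (natural_filtration Y).
Proof.
move=> mY; split=> [t|t|s t st].
- exact: smallest_sigma_algebra.
- apply: smallest_sub; first exact: sigma_algebra_measurable.
  by move=> _ [s _ [A mA <-]]; exact: mY.
- apply: sub_sigma_algebra2 => A [r /= rs rA]; exists r => //=.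
  exact: le_trans st.
Qed.

Lemma natural_filtration_adapted (Y : Omega -> path_space R d) :
  adapted (natural_filtration Y) Y.
Proof.
move=> t A mA; apply: sub_sigma_algebra; exists t => //=; exists A => //.
by rewrite setTI.
Qed.

Lemma process_drift_integrable i (T : R) : 0 < T ->
  (P \x @lebesgue_measure R)%E.-integrable (setT `*` `[0, T])
    (fun ws => (support_coord i (eta ws.1) * power_rate beta ws.2)%:E).
Proof.
move=> T0.
have mI : measurable (`[0, T]%classic : set R) by exact: measurable_itv.
pose h (s : R) : R := power_rate beta s * \1_(`[0, T]%classic) s.
have mh : measurable_fun setT h.
  by apply: measurable_funM; [exact: measurable_power_rate|exact: measurable_indic].
have h0 s : 0 <= h s by rewrite mulr_ge0 ?power_rate_ge0.
have hT : (\int[lebesgue_measure]_s (h s)%:E = (T `^ beta)%:E)%E.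
  rewrite -integral_power_rate ?(ltW T0)// [RHS]integral_mkcond.
  apply: eq_integral => s _; rewrite patchE /h indicE.
  by case: ifP => _; rewrite ?mulr1 ?mulr0.
have ms : measurable_fun setT (fun w => support_coord i (eta w)).
  by apply: measurableT_comp; [exact: measurable_support_coord|exact: measurable_funP].
apply/integrable_mkcond; first exact: measurableX.
rewrite [X in _.-integrable _ X](_ : _ = fun ws : Omega * measurableTypeR R =>
    (support_coord i (eta ws.1) * h ws.2)%:E); last first.
  apply/funext => -[w s]; rewrite patchE /h indicE /=.
  case: (boolP (s \in _)) => [|/negP] sT.
    by rewrite mem_set ?mulr1//; split=> //; move: sT; rewrite inE.
  rewrite memNset ?mulr0// => -[_ /= sT']; apply: sT; rewrite inE; exact: sT'.
have mf : measurable_fun setT (fun ws : Omega * measurableTypeR R =>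
    (support_coord i (eta ws.1) * h ws.2)%:E).
  apply/measurable_EFinP; apply: measurable_funM.
    exact: (measurableT_comp ms measurable_fst).
  exact: (measurableT_comp mh measurable_snd).
apply/integrable12ltyP => //.
have [K K0 hK] := support_coord_bounded i.
have E w : (\int[lebesgue_measure]_s `|(support_coord i (eta w) * h s)%:E| =
    (`|support_coord i (eta w)| * T `^ beta)%:E)%E.
  under eq_integral => s _ do rewrite abse_EFin normrM (ger0_norm (h0 s)) EFinM.
  rewrite ge0_integralZl//; first by rewrite hT.
  - exact/measurable_EFinP.
  - by move=> s _; rewrite lee_fin.
under eq_integral do rewrite E.
apply: (@le_lt_trans _ _ (\int[P]_w (K * T `^ beta)%:E)%E).
  apply: ge0_le_integral => //.
  - by move=> w _; rewrite lee_fin mulr_ge0 ?powR_ge0.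
  - apply/measurable_EFinP; apply: measurable_funM => //; exact: measurableT_comp.
  - by move=> w _; rewrite lee_fin ler_wpM2r ?powR_ge0.
rewrite integral_cst//; apply: lte_mul_pinfty => //.
  by rewrite lee_fin mulr_ge0 ?powR_ge0.
by apply: le_lt_trans (probability_le1 P measurableT) _; exact: ltry.
Qed.

Lemma Rintegral_process_drift w i (t : R) : 0 <= t ->
  \int[@lebesgue_measure R]_(s in `[0, t])
    (support_coord i (eta w) * power_rate beta s) =
  support_coord i (eta w) * t `^ beta.
Proof.
move=> t0; have it := integral_power_rate beta0 t0.
rewrite RintegralZl//; first by rewrite /Rintegral it.
apply/integrableP; split.
  by apply/measurable_EFinP/measurable_funTS; exact: measurable_power_rate.
under eq_integral => s _ do rewrite /= ger0_norm ?power_rate_ge0//.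
by rewrite it ltry.
Qed.

Lemma measurable_process z : measurable_fun setT (Xp z).
Proof.
apply: measurableT_comp; first exact: measurable_barenblatt_path.
exact: measurable_funP.
Qed.

Lemma barenblatt_process_weak_solution z :
  weak_solution m P (natural_filtration (Xp z)) (Xp z).
Proof.
split.
- apply: natural_filtration_filtration => t.
  exact: (measurableT_comp (@measurable_path_at R d t) (measurable_process z)).
- exact: natural_filtration_adapted.
- exists (process_density z), (process_grad z) => b.
  have bE i w s : b i w s = support_coord i (eta w) * power_rate beta s.
    exact: process_drift.
  split.
  + move=> t t0; have -> : process_density z (rtime t) = barenblatt m z (rtime t).
      by rewrite /process_density t0.
    split; last 2 first.
    * exact: barenblatt_Pstar.
    * exact: barenblatt_weak_gradient.
    move=> A mA; have := barenblatt_process_marginals z t mA.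
    by rewrite barenblatt_flow_gt0.
  + move=> T i T0.
    have := process_drift_integrable i T0; congr (_.-integrable _ _).
    by apply/funext => -[w s] /=; rewrite bE.
  + move: eta_support; apply: filterS => w Bw t i.
    rewrite (barenblatt_path0 z (eta w) (rtime_to_time (lexx 0))).
    rewrite barenblatt_pathE !mxE; congr (_ + _).
    under eq_Rintegral do rewrite bE.
    rewrite Rintegral_process_drift ?rtime_ge0// mulrC.
    by rewrite /support_coord (negbTE Bw).
Qed.

End barenblatt_process.

(** * Uniqueness of weak solutions *)

Section drift_identification.
Variables (R : realType) (d : nat) (m : R).
Hypotheses (d_gt0 : (0 < d)%N) (m_gt1 : 1 < m).
Hypothesis mass1 : density_law (@barenblatt R d m 0 1) setT = 1%E.
Local Notation beta := (barenblatt_beta d m).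
Local Notation mu := (lebesgue_rV R d).

(** The law determines the density, hence its m-th power and the weak gradient,
    up to null sets; so the drift can be computed for the profile. *)
Lemma drift_identification (z : 'rV[R]_d) (t : R) u g : 0 < t ->
  Pstar m u -> is_weak_gradient (fun x => u x `^ m) g ->
  same_law (density_law u) (density_law (barenblatt m z t)) ->
  {ae mu, forall x, barenblatt m z t x != 0 -> pme_drift u g x = (beta / t) *: (x - z)}.
Proof.
move=> t0 [pu _] wg ul.
have mB : measurable_fun setT (barenblatt m z t) by exact: measurable_barenblatt.
have mu_ : measurable_fun setT u by case: pu.
have uB := density_law_ae_eq pu mB ul.
have mpow (f : 'rV[R]_d -> R) : measurable_fun setT f ->
    measurable_fun setT (fun x => f x `^ m).
  by move=> mf; apply: (measurableT_comp (measurable_powR m) mf).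
have uBm : {ae mu, forall x, u x `^ m = barenblatt m z t x `^ m}.
  by move: uB; apply: filterS => x ->.
have wB := barenblatt_weak_gradient d_gt0 m_gt1 (barenblatt_C d m) z t0.
have gB i := weak_gradient_unique (mpow _ mu_) (mpow _ mB) uBm wg wB i.
have gB' : {ae mu, forall x i, g x 0 i = barenblatt_grad m (barenblatt_C d m) z t x 0 i}.
  exact: (@filter_forall _ _ _ _ (ae_filter_ringOfSetsType mu) gB).
move: uB gB'; apply: filterS2 => x uB gB0 B0.
rewrite -(barenblatt_drift t0 B0) /pme_drift uB.
by congr (if _ then _ else _); congr (- (_ *: _)); apply/rowP => i.
Qed.

Variables (dO : measure_display) (Omega : measurableType dO) (P : probability Omega R).
Variable Y : Omega -> 'rV[R]_d.
Hypothesis mY : measurable_fun setT Y.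

(** The law of Y charges neither Lebesgue null sets nor the set on which its
    density vanishes. *)
Lemma drift_along (z : 'rV[R]_d) (t : R) u g : 0 < t ->
  Pstar m u -> is_weak_gradient (fun x => u x `^ m) g ->
  same_law (pushforward P Y) (density_law u) ->
  same_law (pushforward P Y) (density_law (barenblatt m z t)) ->
  {ae P, forall w, pme_drift u g (Y w) = (beta / t) *: (Y w - z)}.
Proof.
move=> t0 pu wg Yu YB.
have uB : same_law (density_law u) (density_law (barenblatt m z t)).
  by move=> A mA; rewrite -Yu// YB.
have mB : measurable_fun setT (barenblatt m z t) by exact: measurable_barenblatt.
have h1 := ae_of_density mY mB YB (drift_identification t0 pu wg uB).
have h2 := ae_density_neq0 mY mB YB.
by move: h1 h2; apply: filterS2 => w; exact.
Qed.

End drift_identification.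

Section power_ode.
Variables (R : realType) (b : R) (x : R -> R).
Hypothesis cx : continuous x.
Hypothesis ode : forall e t, 0 < e -> e < t ->
  x t - x e = \int[@lebesgue_measure R]_(s in `[e, t]) (b / s * x s).

Let f (s : R) : R := b / s * x s.

Let cf (s : R) : 0 < s -> {for s, continuous f}.
Proof.
move=> s0; apply: cvgM; last exact: cx.
by apply: cvgM; [exact: cvg_cst|apply: cvgV; [rewrite gt_eqF|exact: cvg_id]].
Qed.

Lemma power_ode_derive (s : R) : 0 < s -> is_derive s 1 x (b / s * x s).
Proof.
move=> s0.
have e0 : 0 < s / 2 by rewrite divr_gt0.
have es : s / 2 < s by lra.
have fi : lebesgue_measure.-integrable `[s / 2, s + 1] (EFin \o f).
  apply: continuous_compact_integrable; first exact: segment_compact.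
  apply: continuous_in_subspaceT => r; rewrite inE/= in_itv/= => /andP[er _].
  by apply: cf; exact: lt_le_trans er.
have s1 : s < s + 1 by rewrite ltrDl.
have [|dF FE] := continuous_FTC1 s1 fi _ (cf s0); first by rewrite /= lte_fin.
set F := fun t => \int[lebesgue_measure]_(r in `[s / 2, t]) f r in dF FE.
apply: (@near_eq_is_derive R R R (fun t => x (s / 2) + F t) x s 1).
  near=> t; rewrite /F -ode//; first by rewrite addrC subrK.
  by near: t; exact: lt_nbhsr.
rewrite -[b / s * x s]add0r; apply: is_deriveD.
apply: DeriveDef; first exact: dF.
by rewrite -derive1E; exact: FE.
Unshelve. all: by end_near. Qed.

(** The derivative of s^(- b) x s vanishes for s > 0. *)
Lemma power_ode_unique (t : R) : 0 < t -> x t = t `^ b * x 1.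
Proof.
move=> t0; pose y (s : R) : R := s `^ (- b) * x s.
have dy (s : R) : 0 < s -> is_derive s 1 y 0.
  move=> s0.
  apply: (is_derive_eq (is_deriveM (is_derive1_powR (- b) s0) (power_ode_derive s0))).
  rewrite /GRing.scale/= powRD ?(gt_eqF s0) ?implybT//.
  by rewrite powR_inv1 ?ltW//; field; rewrite gt_eqF.
have yE (r s : R) : 0 < r -> r < s -> y s = y r.
  move=> r0 rs; apply/eqP; rewrite -subr_eq0; apply/eqP.
  have cy : {within `[r, s], continuous y}.
    apply: continuous_in_subspaceT => c; rewrite inE/= in_itv/= => /andP[rc _].
    apply/differentiable_continuous/derivable1_diffP.
    exact: (@ex_derive _ _ _ _ _ _ _ (dy c (lt_le_trans r0 rc))).
  have dyrs c : c \in `]r, s[ -> is_derive c 1 y 0.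
    by rewrite in_itv/= => /andP[rc _]; apply: dy; exact: lt_trans rc.
  by have [c _ ->] := MVT rs dyrs cy; rewrite mul0r.
have y1 : y t = x 1.
  have -> : x 1 = y 1 by rewrite /y powR1 mul1r.
  by have [t1|t1|->//] := ltgtP t 1; [rewrite (yE t 1)|rewrite (yE 1 t)].
by rewrite -y1 /y mulrA -powRD ?(gt_eqF t0) ?implybT// subrr powRr0 mul1r.
Qed.

End power_ode.

Section almost_everywhere_sections.
Local Open Scope ereal_scope.
Context d1 d2 (T1 : measurableType d1) (T2 : measurableType d2) (R : realType).
Variables (m1 : {sigma_finite_measure set T1 -> \bar R})
          (m2 : {sigma_finite_measure set T2 -> \bar R}).

(** The two iterated integrals of E agree, and one of them is 0. *)
Lemma ae_sections (E : T1 * T2 -> \bar R) : measurable_fun setT E ->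
  (forall xy, 0 <= E xy) ->
  (forall y, {ae m1, forall x, E (x, y) = 0}) ->
  {ae m1, forall x, {ae m2, forall y, E (x, y) = 0}}.
Proof.
move=> mE E0 Ey.
have E12 : \int[m1]_x `|\int[m2]_y E (x, y)| = 0.
  under eq_integral => x _ do rewrite gee0_abs ?integral_ge0//.
  rewrite fubini_tonelli//; apply: integral0_eq => y _.
  rewrite -(integral0 m1 setT); apply: ae_eq_integral => //.
    exact: (measurableT_comp mE (measurable_pair2 y)).
  by move: (Ey y); apply: filterS => x + _.
move/(ae_eq_integral_abs m1 measurableT
  (measurable_fun_fubini_tonelli_F _ mE E0)) : E12.
apply: filterS => x /= /(_ I) Ex.
have : \int[m2]_y `|E (x, y)| = 0.
  by rewrite -[RHS]Ex; apply: eq_integral => y _; rewrite gee0_abs.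
move/(ae_eq_integral_abs m2 measurableT
  (measurableT_comp mE (measurable_pair1 x))).
by apply: filterS => y /= /(_ I).
Qed.

End almost_everywhere_sections.

Section almost_sure_equal_laws.
Context dO dT (Omega : measurableType dO) (T : measurableType dT) (R : realType).
Variable P : probability Omega R.

Lemma ae_eq_pushforward (X Y : Omega -> T) (A : set T) :
  measurable_fun setT X -> measurable_fun setT Y -> measurable A ->
  {ae P, forall w, X w = Y w} -> pushforward P X A = pushforward P Y A.
Proof.
move=> mX mY mA [N [mN N0 XYN]]; rewrite /pushforward.
have mXA : measurable (X @^-1` A) by rewrite -[X in measurable X]setTI; exact: mX.
have mYA : measurable (Y @^-1` A) by rewrite -[X in measurable X]setTI; exact: mY.
rewrite -(measureU0 mXA mN N0) -(measureU0 mYA mN N0); congr (P _).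
apply/seteqP; split => w [|Nw]; try by right.
  move=> XA; have [Nw|nNw] := pselect (N w); [by right|left].
  have XY : X w = Y w by apply: contrapT => /XYN.
  by rewrite /preimage/= -XY.
move=> YA; have [Nw|nNw] := pselect (N w); [by right|left].
have XY : X w = Y w by apply: contrapT => /XYN.
by rewrite /preimage/= XY.
Qed.

End almost_sure_equal_laws.

Section uniqueness.
Variables (R : realType) (d : nat) (m : R).
Hypotheses (d_gt0 : (0 < d)%N) (m_gt1 : 1 < m).
Hypothesis mass1 : density_law (@barenblatt R d m 0 1) setT = 1%E.
Local Notation beta := (barenblatt_beta d m).
Local Notation leb1 := (@lebesgue_measure R).
Variables (dO : measure_display) (Omega : measurableType dO) (P : probability Omega R).
Variables (G : time R -> set (set Omega)) (X : Omega -> path_space R d) (z : 'rV[R]_d).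
Hypothesis Xsol : weak_solution m P G X.
Hypothesis Xmarg : has_barenblatt_marginals m z P X.

Lemma weak_solution_measurable t : measurable_fun setT (fun w => X w t).
Proof.
have [[_ Gm _] adX _] := Xsol.
by move=> _ A mA; rewrite setTI; apply: (Gm t); exact: adX.
Qed.
Let mX := weak_solution_measurable.

Let c i (w : Omega) (s : R) : R := beta * s `^ (-1) * (X w (to_time s) 0 i - z 0 i).

Let mc i : measurable_fun setT (fun ws : Omega * measurableTypeR R => c i ws.1 ws.2).
Proof.
apply: measurable_funM.
  apply: measurable_funM => //.
  exact: (measurableT_comp (measurable_powR (-1)) measurable_snd).
by apply: measurable_funB => //; exact: measurable_path_joint.
Qed.

(** Fubini exchanges the quantifiers: a drift known almost surely at each time is
    known, almost surely, at almost every time. Quantifying over the intervals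
    [0, n + 1] inside leaves a single exceptional set of paths. *)
Lemma drift_almost_everywhere (b : 'I_d -> Omega -> R -> R) :
  (forall t, 0 < t -> {ae P, forall w, forall i, b i w t = c i w t}) ->
  (forall (T : R) i, 0 < T -> (P \x leb1)%E.-integrable (setT `*` `[0, T])
     (fun ws => (b i ws.1 ws.2)%:E)) ->
  {ae P, forall w, forall (n : nat) i,
    leb1.-integrable `[0, n.+1%:R] (EFin \o b i w) /\
    {ae leb1, forall s, s \in `]0, n.+1%:R] -> b i w s = c i w s}}.
Proof.
move=> bc bi.
apply: ae_foralln => n.
apply: (@filter_forall _ _ _ _ (ae_filter_ringOfSetsType P)) => i.
set T : R := n.+1%:R.
have T0 : 0 < T by rewrite ltr0n.
pose D : set (Omega * measurableTypeR R) := setT `*` `[0, T].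
pose D' : set (Omega * measurableTypeR R) := setT `*` `]0, T].
have mD : measurable D by apply: measurableX => //; exact: measurable_itv.
have mD' : measurable D' by apply: measurableX => //; exact: measurable_itv.
have D'D : D' `<=` D.
  move=> [w s] [_ /=]; rewrite in_itv/= => /andP[s0 sT]; split=> //=.
  by rewrite in_itv/= ltW.
have biT := bi T i T0.
pose E := (fun ws : Omega * measurableTypeR R =>
   `|b i ws.1 ws.2 - c i ws.1 ws.2|%:E) \_ D'.
have mE : measurable_fun setT E.
  apply/(measurable_restrictT _ mD'); apply/measurable_EFinP.
  apply: measurableT_comp => //; apply: measurable_funB.
    by apply/measurable_EFinP; apply: measurable_funS (measurable_int _ biT).
  by apply: measurable_funTS; exact: mc.
have E0 ws : (0 <= E ws)%E by rewrite /E patchE; case: ifP.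
have Es s : {ae P, forall w, E (w, s) = 0%E}.
  have [sT|sT] := boolP (s \in `]0, T]); last first.
    apply: nearW => w; rewrite /E patchE memNset// => -[_ /=].
    by move: sT => /negP.
  have s0 : 0 < s by move: sT; rewrite in_itv/= => /andP[].
  move: (bc s s0); apply: filterS => w /(_ i) bcw.
  by rewrite /E patchE; case: ifP => // _; rewrite bcw subrr normr0.
have h1 := @ae_sections _ _ _ _ _ P leb1 E mE E0 Es.
have h2 : {ae P, forall w, leb1.-integrable `[0, T] (EFin \o b i w)}.
  move: (ae_integrable1 ((integrable_mkcond _ mD).1 biT)); apply: filterS => w.
  rewrite [X in _.-integrable setT X -> _](_ : _ = ((EFin \o b i w) \_ `[0, T])).
    by move=> h; apply/integrable_mkcond; [exact: measurable_itv|exact: h].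
  apply/funext => s; rewrite !patchE; congr (if _ then _ else _).
  by apply/idP/idP; rewrite !inE /D /=; [case|split].
move: h1 h2; apply: filterS2 => w h1 h2; split=> //.
move: h1; apply: filterS => s; rewrite /E patchE => + sT.
rewrite mem_set; last by split.
by move=> [] /eqP; rewrite normr_eq0 subr_eq0 => /eqP.
Qed.

Let drift_of_barenblatt (u : R -> 'rV[R]_d -> R) (g : R -> 'rV[R]_d -> 'rV[R]_d) :
  (forall t : time R, 0 < rtime t ->
    [/\ same_law (pushforward P (fun w => X w t)) (density_law (u (rtime t))),
        Pstar m (u (rtime t)) &
        is_weak_gradient (fun x => u (rtime t) x `^ m) (g (rtime t))]) ->
  forall t, 0 < t -> {ae P, forall w, forall i,
    pme_drift (u t) (g t) (X w (to_time t)) 0 i = c i w t}.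
Proof.
move=> ug t t0; have rt : rtime (to_time t) = t by rewrite rtime_to_time// ltW.
have [Xu pu wg] : [/\
    same_law (pushforward P (fun w => X w (to_time t))) (density_law (u t)),
    Pstar m (u t) & is_weak_gradient (fun x => u t x `^ m) (g t)].
  by have := ug (to_time t); rewrite rt; apply.
have XB : same_law (pushforward P (fun w => X w (to_time t)))
    (density_law (barenblatt m z t)).
  by move=> A mA; rewrite Xmarg// barenblatt_flow_gt0 rt.
move: (drift_along d_gt0 m_gt1 (mX _) t0 pu wg Xu XB); apply: filterS => w -> i.
by rewrite /c powR_inv1 ?(ltW t0)// !mxE.
Qed.

(** The linear equation is singular at time 0 and has many solutions that leave
    z. On positive times a solution is fixed by its value at time 1, and so this
    value serves as the parameter of the path. *)
Lemma weak_solution_path : {ae P, forall w,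
  X w = barenblatt_path m_gt1 z (X w (to_time 1) - z)}.
Proof.
have [_ _ [u [g [ug bi Xint]]]] := Xsol.
set b := fun i w s => pme_drift (u s) (g s) (X w (to_time s)) 0 i in bi Xint.
have h1 := drift_almost_everywhere (drift_of_barenblatt ug) bi.
have h0 : {ae P, forall w, X w (to_time 0) = z}.
  have mz : measurable (~` [set z]) by apply: measurableC; exact: measurable_set1_rV.
  exists ((fun w => X w (to_time 0)) @^-1` (~` [set z])); split.
  - by rewrite -[X in measurable X]setTI; exact: mX.
  - rewrite -[LHS]/(pushforward P _ _) Xmarg// barenblatt_flow0.
      by rewrite diracE memNset//= => /(_ erefl).
    by rewrite rtime_to_time.
  - by [].
move: h0 h1 Xint; apply: filterS3 => w X0 h1 Xint.
(* Subtracting the integral equations at times e and t removes time 0, where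
   the drift is singular. *)
have ode (i : 'I_d) (e t : R) : 0 < e -> e < t ->
    (X w (to_time t) 0 i - z 0 i) - (X w (to_time e) 0 i - z 0 i) =
    \int[leb1]_(s in `[e, t]) (beta / s * (X w (to_time s) 0 i - z 0 i)).
  move=> e0 et; have t0 := lt_trans e0 et.
  have [n tn] : exists n : nat, t <= n.+1%:R.
    by exists (Num.truncn t); exact/ltW/truncnS_gt.
  have [bn bc] := h1 n i.
  have it : leb1.-integrable `[0, t] (EFin \o b i w).
    apply: integrableS bn => //.
    by move=> s /=; rewrite !in_itv/= => /andP[-> st]; exact: le_trans tn.
  have iet : leb1.-integrable `[e, t] (EFin \o b i w).
    apply: integrableS it => //.
    by move=> s /=; rewrite !in_itv/= => /andP[es ->]; rewrite (le_trans (ltW e0)).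
  have ieto : leb1.-integrable `]e, t] (EFin \o b i w).
    by apply: integrableS iet => //; exact: subset_itv_oc_cc.
  rewrite opprB addrA subrK (Xint (to_time t) i) (Xint (to_time e) i).
  rewrite !rtime_to_time ?ltW// opprD addrACA subrr add0r.
  rewrite Rintegral_itvB//; last 2 first.
  - by rewrite bnd_simp ltW.
  - by rewrite bnd_simp ltW.
  rewrite Rintegral_itv_obnd_cbnd//.
  congr fine; apply: ae_eq_integral => //.
  - exact: measurable_int iet.
  - apply: (@eq_measurable_fun _ _ _ _ _ (EFin \o c i w)).
      move=> s; rewrite inE/= in_itv/= => /andP[es _].
      by rewrite /c powR_inv1// ltW// (lt_le_trans e0 es).
    apply/measurable_EFinP/measurable_funTS.
    exact: (measurableT_comp (mc i) (measurable_pair1 w)).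
  - move: bc; apply: (@filterS _ _ (ae_filter_ringOfSetsType leb1)) => s bc /=.
    rewrite in_itv/= => /andP[es st].
    have bcs : b i w s = c i w s.
      by apply: bc; rewrite in_itv/= (lt_le_trans e0 es) (le_trans st).
    by congr EFin; rewrite [LHS]bcs /c powR_inv1// ltW// (lt_le_trans e0 es).
have Xt (t : R) : 0 < t -> X w (to_time t) = z + t `^ beta *: (X w (to_time 1) - z).
  move=> t0; apply/rowP => i.
  have cx : continuous (fun s : R => X w (to_time s) 0 i - z 0 i).
    by move=> s; apply: (cvgB (@path_coord_continuous R d (X w) i s) (cvg_cst (z 0 i))).
  have := power_ode_unique cx (ode i) t0.
  by rewrite !mxE => <-; rewrite addrC subrK.
apply/continuousEP => t; rewrite barenblatt_pathE.
have := rtime_ge0 t; rewrite le_eqVlt => /predU1P[/esym t0|t0].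
  rewrite t0 powR0 ?gt_eqF ?barenblatt_beta_gt0// scale0r addr0 -X0.
  by congr (X w _); rewrite -(to_timeK t) t0.
by rewrite -(Xt _ t0) to_timeK.
Qed.

(** Almost surely X is the image of X_1 under a fixed measurable map. *)
Lemma weak_solution_law (A : set (path_space R d)) : measurable A ->
  pushforward P X A = barenblatt_flow m (to_time 1) z
    [set y | A (barenblatt_path m_gt1 z (y - z))].
Proof.
move=> mA.
have mXX : measurable_fun setT X by exact: measurable_fun_path.
have mB : measurable_fun setT (fun y : 'rV[R]_d => barenblatt_path m_gt1 z (y - z)).
  apply: measurable_fun_path => t; apply: measurable_fun_mx => i j.
  under eq_fun do rewrite barenblatt_pathE !mxE.
  apply: measurable_funD => //; apply: measurable_funM => //.
  by apply: measurable_funB => //; exact: measurable_coord.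
have mA' : measurable [set y | A (barenblatt_path m_gt1 z (y - z))].
  by rewrite -[X in measurable X]setTI; exact: mB.
rewrite (ae_eq_pushforward mXX _ mA weak_solution_path); last first.
  exact: (measurableT_comp mB (mX _)).
by rewrite -Xmarg.
Qed.

End uniqueness.

(** * The nonlinear Markov core *)

Section laws_of_maps.
Context dO dT (Omega : measurableType dO) (T : measurableType dT) (R : realType).
Variables (P : probability Omega R) (X : Omega -> T).
Hypothesis mX : measurable_fun setT X.

Definition measurable_map : {mfun Omega >-> T} :=
  HB.pack X (isMeasurableFun.Build _ _ _ _ X mX).

Definition law_of : probability T R := distribution P measurable_map.

Lemma law_ofE (B : set T) : law_of B = P (X @^-1` B).
Proof. by []. Qed.

Lemma ge0_integral_law_of (F : set T) (f : T -> \bar R) : measurable F ->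
  measurable_fun setT f -> (forall x, 0 <= f x)%E ->
  (\int[law_of]_(x in F) f x = \int[P]_(w in X @^-1` F) f (X w))%E.
Proof.
move=> mF mf f0.
have := @ge0_integral_pushforward _ _ _ _ R X mX P F f mF (measurable_funTS mf).
by apply => x _.
Qed.

End laws_of_maps.

Section path_filtration.
Variables (R : realType) (d : nat).
Local Notation path := (path_space R d).

Lemma path_filtration_measurable (s : time R) : path_filtration s `<=` @measurable _ path.
Proof.
have [_ h _] := natural_filtration_filtration (@measurable_path_at R d).
exact: h.
Qed.

(** The sets with this property form a sigma-algebra that contains the events
    that the coordinates up to time s define. *)
Lemma path_filtration_agree (s : time R) (F : set path) (v w : path) :
  path_filtration s F -> (forall r, rtime r <= rtime s -> v r = w r) -> F v -> F w.
Proof.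
pose S : set (set path) := [set F | forall v w : path,
  (forall r, rtime r <= rtime s -> v r = w r) -> F v -> F w].
suff : path_filtration s `<=` S by move=> h /h; apply.
apply: smallest_sub; last first.
  by move=> _ [r rs [A mA <-]] v' w' vw; rewrite setTI /preimage/= (vw r rs).
split=> [v' w' _ []|A SA v' w' vw [_ Av]|A SA v' w' vw [i _ Ai]].
  split=> // Aw; apply: Av; apply: SA Aw => r rs; exact/esym/vw.
by exists i => //; exact: SA vw Ai.
Qed.

Lemma measurable_path_shift (s : time R) : measurable_fun setT (@path_shift R d s).
Proof. by apply: measurable_fun_path => t; exact: (@measurable_path_at R d (addt s t)). Qed.

End path_filtration.

Section markov_core.
Variables (R : realType) (d : nat) (m : R).
Hypotheses (d_gt0 : (0 < d)%N) (m_gt1 : 1 < m).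
Variables (dO : measure_display) (Omega : measurableType dO) (P : probability Omega R).
Variable eta : {RV P >-> 'rV[R]_d}.
Hypothesis eta_law : same_law (distribution P eta) (density_law (barenblatt m 0 1)).
Local Notation beta := (barenblatt_beta d m).
Local Notation path := (path_space R d).
Local Notation flow := (@barenblatt_flow R d m).
Local Notation Xp z := (fun w : Omega => barenblatt_path m_gt1 z (eta w)).
Let mass1 := barenblatt_mass1 eta_law.

Definition process_law (z : 'rV[R]_d) : probability path R :=
  law_of P (measurable_process m_gt1 eta z).

Definition late_process (r : time R) (z : 'rV[R]_d) (w : Omega) : path :=
  path_shift r (barenblatt_path m_gt1 z (eta w)).

Lemma measurable_late_process r z : measurable_fun setT (late_process r z).
Proof.
exact: (measurableT_comp (@measurable_path_shift R d r) (measurable_process m_gt1 eta z)).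
Qed.

Lemma late_process0 r z w : rtime r = 0 ->
  late_process r z w = barenblatt_path m_gt1 z (eta w).
Proof.
move=> r0; apply/continuousEP => t.
rewrite -[LHS]/(barenblatt_path m_gt1 z (eta w) (addt r t)).
congr (barenblatt_path m_gt1 z (eta w) _).
exact: add0t.
Qed.

Definition late_law r z : probability path R := law_of P (measurable_late_process r z).

Lemma late_law_marginal r z s :
  same_law (marginal (late_law r z) s) (flow (addt r s) z).
Proof. by move=> A mA; rewrite -(barenblatt_process_marginals d_gt0 m_gt1 eta_law z). Qed.

(** Unambiguous by [barenblatt_flow_inj]: this is how a kernel can be chosen that
    depends on a law alone. *)
Definition flow_point (zeta : set 'rV[R]_d -> \bar R) : time R * 'rV[R]_d :=
  xget (to_time 0, 0) [set tz | same_law zeta (flow tz.1 tz.2)].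

Lemma flow_pointE zeta t z : same_law zeta (flow t z) -> flow_point zeta = (t, z).
Proof.
move=> h.
have ex : exists tz,
    [set tz : time R * 'rV[R]_d | same_law zeta (flow tz.1 tz.2)] tz.
  by exists (t, z).
have := xgetPex (to_time 0, 0) ex; rewrite -/(flow_point zeta) /=.
case: (flow_point zeta) => t' z' /= h'.
have [|-> ->//] := @barenblatt_flow_inj R d m d_gt0 m_gt1 mass1 t' t z' z.
by move=> A mA; rewrite -h'// h.
Qed.

Definition flow_path_law (zeta : probability 'rV[R]_d R) : probability path R :=
  late_law (flow_point zeta).1 (flow_point zeta).2.

Lemma flow_path_lawE (zeta : probability 'rV[R]_d R) t z :
  same_law zeta (flow t z) -> flow_path_law zeta = late_law t z.
Proof. by rewrite /flow_path_law => /flow_pointE ->. Qed.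

(** The path that passes through y at time r among the trajectories leaving z,
    seen from time r on. *)
Definition resume r z (y : 'rV[R]_d) : path :=
  path_shift r (barenblatt_path m_gt1 z (rtime r `^ (- beta) *: (y - z))).

Lemma resumeE r z y t : resume r z y t =
  z + rtime (addt r t) `^ beta *: (rtime r `^ (- beta) *: (y - z)).
Proof. by []. Qed.

Lemma measurable_resume r z : measurable_fun setT (resume r z).
Proof.
apply: measurable_fun_path => t; apply: measurable_fun_mx => i j.
under eq_fun do rewrite resumeE !mxE.
apply: measurable_funD; first exact: measurable_cst.
apply: measurable_funM; first exact: measurable_cst.
apply: measurable_funM; first exact: measurable_cst.
by apply: measurable_funB; [exact: measurable_coord|exact: measurable_cst].
Qed.

Lemma powR_cancel r (y : 'rV[R]_d) : 0 < rtime r ->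
  rtime r `^ (- beta) *: (rtime r `^ beta *: y) = y.
Proof.
by move=> r0; rewrite scalerA -powRD ?(gt_eqF r0) ?implybT// addNr powRr0 scale1r.
Qed.

Lemma resume_path r z y : 0 < rtime r ->
  resume r z (barenblatt_path m_gt1 z y r) = path_shift r (barenblatt_path m_gt1 z y).
Proof.
by move=> r0; rewrite /resume barenblatt_pathE addrAC subrr add0r powR_cancel.
Qed.

Lemma resume0 r z y : 0 < rtime r -> resume r z y (to_time 0) = y.
Proof.
move=> r0; rewrite resumeE addt0.
by rewrite scalerA mulrC -scalerA powR_cancel// addrC subrK.
Qed.

Definition start_kernel z : R.-pker 'rV[R]_d ~> path :=
  kprobability (measurable_cst (process_law z : pprobability path R)).

Definition resume_kernel r z : R.-pker 'rV[R]_d ~> path :=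
  kdirac (measurable_resume r z).

(** At positive times the position determines the rest of the path; at time 0 it
    is almost surely the centre and says nothing about the path. *)
Definition core_kernel (zeta : set 'rV[R]_d -> \bar R) : R.-pker 'rV[R]_d ~> path :=
  let: (r, z) := flow_point zeta in
  if rtime r == 0 then start_kernel z else resume_kernel r z.

Lemma core_kernel0 zeta r z y B : same_law zeta (flow r z) -> rtime r = 0 ->
  core_kernel zeta y B = process_law z B.
Proof. by move=> /flow_pointE h r0; rewrite /core_kernel h r0 eqxx. Qed.

Lemma core_kernel_gt0 zeta r z y B : same_law zeta (flow r z) -> 0 < rtime r ->
  core_kernel zeta y B = (\1_B (resume r z y))%:E.
Proof. by move=> /flow_pointE h r0; rewrite /core_kernel h gt_eqF. Qed.

(** At a positive time r the process resumed from its own position at time r is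
    the process itself after time r. *)
Lemma core_kernel_disintegration (xi : probability 'rV[R]_d R) r z :
  same_law xi (flow r z) -> is_disintegration (flow_path_law xi) xi (core_kernel xi).
Proof.
move=> xiE; rewrite (flow_path_lawE xiE).
have := rtime_ge0 r; rewrite le_eqVlt => /predU1P[/esym r0|r0].
  split=> [B mB|].
    under eq_integral do rewrite (core_kernel0 _ _ xiE r0).
    rewrite integral_cst//.
    rewrite [X in (_ * X)%E](_ : _ = 1%E); last exact: probability_setT.
    rewrite mule1 [LHS]law_ofE [RHS]law_ofE; congr (P _).
    by apply/funext => w; rewrite /preimage/= late_process0.
  have mz : measurable (~` [set z]) by apply: measurableC; exact: measurable_set1_rV.
  exists (~` [set z]); split=> //.
    by rewrite xiE// barenblatt_flow0// diracE memNset//= => /(_ erefl).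
  move=> y /= hy yz; apply: hy; rewrite yz (core_kernel0 _ _ xiE r0) law_ofE.
  rewrite -(@probability_setT _ _ _ P); congr (P _).
  apply/seteqP; split=> // w _ /=; apply: barenblatt_path0 => //.
  by rewrite rtime_to_time.
split=> [B mB|]; last first.
  apply: nearW => y; rewrite (core_kernel_gt0 _ _ xiE r0) indicE mem_set//=.
  exact: resume0.
have mpre : measurable (resume r z @^-1` B).
  by rewrite -[X in measurable X]setTI; exact: measurable_resume.
under eq_integral do
  rewrite (core_kernel_gt0 _ _ xiE r0) -[\1_B _]/(\1_(resume r z @^-1` B) _).
transitivity (xi (resume r z @^-1` B)); last by rewrite integral_indic// setIT.
rewrite xiE// -(barenblatt_process_marginals d_gt0 m_gt1 eta_law z r mpre).
by rewrite law_ofE; congr (P _); apply/funext => w; rewrite /preimage/= resume_path.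
Qed.

(** If r + s > 0 the kernel, evaluated along the process, is the indicator of the
    event. If r = s = 0 it is constant, equal to the probability of the event, and
    F has probability 0 or 1. *)
Lemma core_kernel_markov (zeta : probability 'rV[R]_d R) r z s t A :
  same_law zeta (flow r z) -> measurable A ->
  is_cond_prob (flow_path_law zeta) (path_filtration s)
    [set w : path | A (w (addt t s))]
    (fun w => core_kernel (marginal (flow_path_law zeta) s) (w s)
       [set w' : path | A (w' t)]).
Proof.
move=> zE mA; rewrite (flow_path_lawE zE).
set xi := marginal _ s; have xiE : same_law xi (flow (addt r s) z).
  exact: late_law_marginal.
have mAt (r' : time R) : measurable [set w : path | A (w r')].
  by rewrite -[X in measurable X]setTI; exact: (@measurable_path_at R d r').
have mg := measurable_kernel (core_kernel xi) _ (mAt t).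
split=> [E mE|F sF].
  apply: sub_sigma_algebra; exists s => //=.
  exists ((fun y => core_kernel xi y [set w' : path | A (w' t)]) @^-1` E).
    by rewrite -[X in measurable X]setTI; exact: mg.
  by rewrite setTI.
have mF := path_filtration_measurable sF.
have mFY : measurable (late_process r z @^-1` F).
  by rewrite -[X in measurable X]setTI; exact: measurable_late_process.
have mBY : measurable (late_process r z @^-1` [set w : path | A (w (addt t s))]).
  by rewrite -[X in measurable X]setTI; exact: measurable_late_process.
rewrite ge0_integral_law_of//; last first.
  exact: (measurableT_comp mg (@measurable_path_at R d s)).
rewrite law_ofE preimage_setI.
have shiftE w : late_process r z w (addt t s) =
    path_shift (addt r s) (barenblatt_path m_gt1 z (eta w)) t.
  rewrite -[LHS]/(barenblatt_path m_gt1 z (eta w) (addt r (addt t s))).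
  by rewrite (addtC t) addtA.
have := rtime_ge0 (addt r s); rewrite le_eqVlt => /predU1P[/esym rs0|rs0]; last first.
  have E w : core_kernel xi (late_process r z w s) [set w' : path | A (w' t)] =
      (\1_(late_process r z @^-1` [set w : path | A (w (addt t s))]) w)%:E.
    rewrite (core_kernel_gt0 _ _ xiE rs0).
    rewrite -[late_process r z w s]/(barenblatt_path m_gt1 z (eta w) (addt r s)).
    rewrite resume_path// !indicE; congr (((nat_of_bool _)%:R)%:E).
    exact: (congr1 (fun v => `[< A v >]) (esym (shiftE w))).
  by under eq_integral do rewrite E; rewrite integral_indic// setIC.
have [r0 s0] := addt_eq0 rs0.
under eq_integral do rewrite (core_kernel0 _ _ xiE rs0).
rewrite integral_cst//.
have -> : late_process r z @^-1` [set w : path | A (w (addt t s))] =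
    (fun w => barenblatt_path m_gt1 z (eta w)) @^-1` [set w' : path | A (w' t)].
  apply/funext => w; rewrite /preimage/= shiftE; congr (A _).
  rewrite -[LHS]/(barenblatt_path m_gt1 z (eta w) (addt (addt r s) t)).
  by congr (barenblatt_path m_gt1 z (eta w) _); exact: add0t.
(* F sees the paths at time 0 only, where all of them are at z. *)
have agree w w' : F (late_process r z w) -> F (late_process r z w').
  apply: (path_filtration_agree sF) => r' r's.
  have r'0 : rtime r' = 0 by apply/eqP; rewrite eq_le rtime_ge0 -s0 r's.
  by rewrite !late_process0// !barenblatt_path0.
have [[w Fw]|nF] := pselect (exists w, F (late_process r z w)).
  have -> : late_process r z @^-1` F = setT.
    by apply/seteqP; split=> // w' _; exact: agree Fw.
  rewrite setIT [X in (_ * X)%E](_ : _ = 1%E) ?mule1//.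
  exact: probability_setT.
have -> : late_process r z @^-1` F = set0.
  by apply/seteqP; split=> // w' Fw; apply: nF; exists w'.
by rewrite setI0 !measure0 mule0.
Qed.

Lemma process_nonlinear_markov_core : nonlinear_markov_core flow process_law.
Proof.
have flow_law (xi zeta : probability 'rV[R]_d R) t z :
    same_law xi zeta -> same_law zeta (flow t z) -> same_law xi (flow t z).
  by move=> xz zE A mA; rewrite xz// zE.
have t0 : rtime (to_time 0 : time R) = 0 by rewrite rtime_to_time.
split=> [z A mA|t z t' z'|t z|].
- by rewrite barenblatt_flow0.
- exact: barenblatt_flow_inj.
- move=> A mA; rewrite -(barenblatt_process_marginals d_gt0 m_gt1 eta_law z)//.
exists flow_path_law; split.
  by move=> t z zeta /flow_path_lawE ->.
split.
- move=> xi zeta xz [t [z zE]]; have xiE := flow_law _ _ _ _ xz zE.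
  split; first by exists t, z.
  by rewrite (flow_path_lawE xiE) (flow_path_lawE zE).
- move=> zeta [t [z zE]]; rewrite (flow_path_lawE zE) => A mA.
  rewrite (late_law_marginal t z (to_time 0) mA) (zE _ mA); congr (flow _ _ _).
  exact: addt0.
- move=> zeta s [t [z zE]] _; exists (addt t s), z.
  by rewrite (flow_path_lawE zE); exact: late_law_marginal.
- exists core_kernel; split=> [xi [t [z xiE]]|s t zeta A [r [z zE]] mA].
    exact: core_kernel_disintegration xiE.
  exact: core_kernel_markov zE mA.
Qed.

End markov_core.
Theorem proposition6p2 (R : realType) (d : nat) (m : R)
    (d_gt0 : (0 < d)%N) (m_gt1 : 1 < m)
    (dO : measure_display) (Omega : measurableType dO) (P : probability Omega R)
    (eta : {RV P >-> 'rV[R]_d})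
    (eta_law : same_law (distribution P eta) (density_law (barenblatt m 0 1))) :
  let X (z : 'rV[R]_d) (w : Omega) : path_space R d :=
    barenblatt_path m_gt1 z (eta w) in
  (forall z,
    [/\ weak_solution m P (natural_filtration (X z)) (X z),
        has_barenblatt_marginals m z P (X z) &
        unique_barenblatt_solution m z]) /\
  exists V : 'rV[R]_d -> probability (path_space R d) R,
    [/\ forall z, same_law (V z) (pushforward P (X z)),
        forall z, solution_path_law m (V z),
        nonlinear_markov_core (barenblatt_flow m) V &
        forall V' : 'rV[R]_d -> probability (path_space R d) R,
          nonlinear_markov_core (barenblatt_flow m) V' ->
          (forall z, solution_path_law m (V' z)) ->
          forall z, same_law (V' z) (V z)].
Proof.
move=> X.
have Xsol z : weak_solution m P (natural_filtration (X z)) (X z).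
  exact: (barenblatt_process_weak_solution d_gt0 m_gt1 eta_law z).
have Xmarg z : has_barenblatt_marginals m z P (X z).
  exact: (barenblatt_process_marginals d_gt0 m_gt1 eta_law z).
have uniq (z : 'rV[R]_d) : unique_barenblatt_solution m z.
  move=> dO1 O1 P1 G1 X1 dO2 O2 P2 G2 X2 sol1 marg1 sol2 marg2 A mA.
  rewrite (weak_solution_law d_gt0 m_gt1 sol1 marg1 mA).
  by rewrite (weak_solution_law d_gt0 m_gt1 sol2 marg2 mA).
split=> [z|]; first by split; [exact: Xsol|exact: Xmarg|exact: uniq].
exists (process_law m_gt1 eta).
have VX z : same_law (process_law m_gt1 eta z) (pushforward P (X z)) by [].
split=> [//|z| |V' [_ _ V'marg _] V'sol z].
- by exists dO, Omega, P, (natural_filtration (X z)), (X z).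
- exact: process_nonlinear_markov_core.
have [dO1 [S1 [P1 [G1 [X1 [X1sol V'X1]]]]]] := V'sol z.
suff X1marg : has_barenblatt_marginals m z P1 X1.
  move=> A mA; rewrite (V'X1 _ mA) (VX z A mA).
  exact: (uniq z _ _ _ _ _ _ _ _ _ _ X1sol X1marg (Xsol z) (Xmarg z) A mA).
move=> t A mA; rewrite -(V'marg t z A mA); apply: esym; apply: V'X1.
by rewrite -[X in measurable X]setTI; exact: (@measurable_path_at R d t).
Qed.
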